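(* Let $(\star)$ be a linear system over $\mathbb{F}_q$ with coefficient matrix $A=(a_{ij})\in\mathbb{F}_q^{m\times k}$ which is of type (RC), non-degenerate and irreducible. Suppose there is a partition $[k]=P_1\cup\dots\cup P_{2s}$ such that: (i) for every $r\in[s]$, the columns of $A$ indexed by $P_r\cup P_{s+r}$ sum to the zero vector; (ii) for every nonzero linear combination $(b_1,\dots,b_k)$ of the rows of $A$, one has $\sum_{j\in P_r}b_j\ne0$ for at least two different values of $r\in[s]$; (iii) for every column equivalence class $C$ of size $2$ that sums to zero, there is some $r\in[s]$ with $C=P_r\cup P_{s+r}$. Then $(\star)$ is moderate.
   Context: Solutions of $(\star)$ are tuples $(x_1,\dots,x_k)\in(\mathbb{F}_q^n)^k$ with $\sum_j a_{ij}x_j=0$ for all $i$. The system is balanced if each row of $A$ sums to $0$. A $(\star)$-shape is a solution with pairwise distinct entries. Moderate: there exist $\beta,\gamma>0$ with $\gamma<q$ such that for every $n$ every $S\subseteq\mathbb{F}_q^n$ with $|S|\ge\beta\gamma^n$ contains a $(\star)$-shape in $S^k$. Indices $j,j'$ are equivalent if columns $j,j'$ of $A$ are nonzero scalar multiples of one another; the classes are the column equivalence classes; a class sums to zero if its columns add up to zero. Type (RC): balanced with at most one column equivalence class of size $1$. Non-degenerate: rows of $A$ linearly independent and no zero column. Two systems are equivalent if each equation of one is a linear combination of those of the other. Reducible: equivalent to a system whose variables can be partitioned into at least two classes with each equation only using variables of one class; otherwise irreducible. *)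

(* Defs.v *)
From HB Require Import structures.
From mathcomp Require Import all_boot all_order all_algebra all_field.
From mathcomp Require Import reals.
Set Implicit Arguments. Unset Strict Implicit. Unset Printing Implicit Defensive.
Import Order.TTheory GRing.Theory Num.Theory.
Local Open Scope ring_scope.

Section Defs.
Variables (F : finFieldType) (m k : nat).
Implicit Type A : 'M[F]_(m, k).

Definition is_solution A n (x : 'I_k -> 'rV[F]_n) : Prop :=
  forall i : 'I_m, \sum_(j < k) A i j *: x j = 0.

Definition is_shape A n (x : 'I_k -> 'rV[F]_n) : Prop :=
  is_solution A x /\ injective x.

Definition moderate (R : realType) A : Prop :=
  exists beta gamma : R, 0 < beta /\ 0 < gamma /\ gamma < (#|F|%:R : R) /\
    forall (n : nat) (S : {set 'rV[F]_n}),
      beta * gamma ^+ n <= (#|S|%:R : R) ->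
      exists x : 'I_k -> 'rV[F]_n, is_shape A x /\ (forall j, x j \in S).

Definition balanced A : Prop := forall i : 'I_m, \sum_(j < k) A i j = 0.

Definition col_equiv A (j j' : 'I_k) : bool :=
  [exists c : F, (c != 0) && (col j A == c *: col j' A)].

Definition col_class A (j : 'I_k) : {set 'I_k} :=
  [set j' | col_equiv A j j'].

Definition is_col_class A (C : {set 'I_k}) : Prop :=
  exists j, C = col_class A j.

Definition class_sums_to_zero A (C : {set 'I_k}) : Prop :=
  \sum_(j in C) col j A = 0.

(* type (RC): balanced, at most one column equivalence class of size 1
   (a class of size 1 is {j} for a unique j, so we count such j) *)
Definition typeRC A : Prop :=
  balanced A /\ (#|[set j | #|col_class A j| == 1%N]| <= 1)%N.

Definition non_degenerate A : Prop :=
  row_free A /\ forall j : 'I_k, col j A != 0.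

Definition equiv_system m' (B : 'M[F]_(m', k)) A : Prop :=
  (B <= A)%MS /\ (A <= B)%MS.

Definition reducible A : Prop :=
  exists (m' : nat) (B : 'M[F]_(m', k)), equiv_system B A /\
  exists (t : nat) (f : 'I_k -> 'I_t), (2 <= t)%N /\
    (forall c : 'I_t, exists j, f j = c) /\
    forall i : 'I_m', exists c : 'I_t, forall j, B i j != 0 -> f j = c.

Definition irreducible A : Prop := ~ reducible A.

End Defs.

(* Main.v *)
Require Import Defs.
From mathcomp Require Import all_boot all_order all_algebra all_field.
From mathcomp Require Import reals ring lra zify.
Import Order.TTheory GRing.Theory Num.Theory.
Local Open Scope ring_scope.
Set Implicit Arguments. Unset Strict Implicit. Unset Printing Implicit Defensive.

(** Write [q = #|F|] and let [S] have at least [b * g ^+ n] points with [g] close to [q].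
    Putting all [x_j] with [j] in [P_r] equal to one point turns the system into
    [\sum_r a_r (u_r - u_(s+r)) = 0], where [a_r] is the sum of the columns in [P_r].
    By Cauchy-Schwarz it has at least [|S|^(2s) / q^(m n)] solutions in [S].
    By (ii) every nonzero combination of its equations involves at least four variables, so
    prescribing one, two or three variables costs the full number of degrees of freedom.
    It remains to move the coinciding points apart inside each column class [C] of size
    at least 2, where only the value of [\sum_(j in C) c_j x_j] matters.
    Let [e_a] be the sum of the [c_j] over the part [a] of [C].
    A part with at least two columns and [e_a != 0] can be spread out for all but exponentially
    few [u_a]: this follows from the cap set bound for [c1 x + c2 y = (c1 + c2) z].
    Singletons are spread out two or three at a time, by pigeonholing on the value of
    the block; a part with [e_a = 0] is absorbed into another one, and (iii) rules out the only
    case in which this is impossible.  The exceptional [u] are too few to exhaust all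
    solutions. *)

(** * Slice rank *)

Section SliceRank.
Variable F : fieldType.

(** The left kernel of [r] has dimension at least [N - M]. A space of rows of dimension [d] projects
    isomorphically onto some [d] coordinates, and there all entries can be prescribed. *)
Lemma exists_row_avoiding N M (r : 'M[F]_(N, M)) :
  exists d (f : 'I_d -> 'I_N) (phi : 'rV[F]_N),
    [/\ (N <= d + M)%N, injective f, phi *m r = 0 & forall i, phi 0 (f i) = 1].
Proof.
pose K := row_base (kermx r).
have Kfull : row_full K^T by rewrite /row_full mxrank_tr; exact: row_base_free.
have Kr : K *m r = 0 by apply/sub_kermxP; rewrite eq_row_base.
pose f := fullrankfun Kfull.
have unitB : (rowsub f K^T)^T \in unitmx by rewrite unitmx_tr fullrowsub_unit.
pose v := const_mx 1 *m invmx (rowsub f K^T)^T : 'rV[F]_(\rank (kermx r)).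
exists (\rank (kermx r)), f, (v *m K); split.
- by rewrite mxrank_ker addnC -leq_subLR leq_sub2l // rank_leq_col.
- exact: fullrankfun_inj.
- by rewrite -mulmxA Kr mulmx0.
- move=> i.
  have -> : (v *m K) 0 (f i) = (v *m (rowsub f K^T)^T) 0 i.
    by rewrite !mxE; apply: eq_bigr => l _; rewrite !mxE.
  by rewrite /v mulmxKV // mxE.
Qed.

(* A functional killing the [r]-slices contracts the diagonal tensor to a diagonal matrix of rank
   at least [N - M], while the other slices contribute rank at most [2 * M]. *)
Lemma slice_rank_diagonal N M (p q r : 'M[F]_(N, M)) (g h l : 'I_M -> 'M[F]_N) :
  (forall x y z, ((x == y) && (x == z))%:R =
     \sum_(a < M) p x a * g a y z + \sum_(a < M) q y a * h a x z
     + \sum_(a < M) r z a * l a x y) ->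
  (N <= 3 * M)%N.
Proof.
move=> tensorE; have [d [f [phi [leN injf phir phif]]]] := exists_row_avoiding r.
pose gf := \matrix_(a < M, y < N) \sum_z phi 0 z * g a y z.
pose hf := \matrix_(x < N, a < M) \sum_z phi 0 z * h a x z.
have diagE : diag_mx phi = p *m gf + hf *m q^T.
  apply/matrixP => x y; rewrite !mxE.
  transitivity (\sum_z phi 0 z * ((x == y) && (x == z))%:R).
    rewrite (bigD1 x) //= eqxx andbT big1 ?addr0 ?mulr_natr //.
    by move=> z zx; rewrite (eq_sym x z) (negPf zx) andbF mulr0.
  have -> : \sum_z phi 0 z * ((x == y) && (x == z))%:R =
     \sum_z (phi 0 z * \sum_(a < M) p x a * g a y z) +
     \sum_z (phi 0 z * \sum_(a < M) q y a * h a x z) +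
     \sum_z (phi 0 z * \sum_(a < M) r z a * l a x y).
    by rewrite -!big_split; apply: eq_bigr => z _; rewrite /= tensorE !mulrDr.
  have -> : \sum_z (phi 0 z * \sum_(a < M) r z a * l a x y) = 0.
    under eq_bigr do rewrite mulr_sumr.
    rewrite exchange_big big1 //= => a _.
    under eq_bigr do rewrite mulrA.
    rewrite -mulr_suml.
    have /matrixP/(_ 0 a) := phir; rewrite !mxE => ->.
    by rewrite mul0r.
  rewrite addr0; congr (_ + _).
    under eq_bigr do rewrite mulr_sumr.
    rewrite exchange_big; apply: eq_bigr => a _.
    by rewrite mxE mulr_sumr; apply: eq_bigr => z _; rewrite mulrCA.
  under eq_bigr do rewrite mulr_sumr.
  rewrite exchange_big; apply: eq_bigr => a _.
  by rewrite !mxE mulr_suml; apply: eq_bigr => z _; rewrite mulrCA mulrC.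
have sub1 : mxsub f f (diag_mx phi) = 1%:M.
  by apply/matrixP => i j; rewrite !mxE (inj_eq injf) phif.
have : (\rank (mxsub f f (diag_mx phi)) <= M + M)%N.
  rewrite diagE.
  have -> : mxsub f f (p *m gf + hf *m q^T) =
     rowsub f p *m colsub f gf + rowsub f hf *m colsub f q^T.
    apply/matrixP => i j; rewrite !mxE; congr (_ + _);
    by apply: eq_bigr => a _; rewrite !mxE.
  apply: leq_trans (mxrank_add _ _) _; apply: leq_add;
  exact: leq_trans (mxrankM_maxl _ _) (rank_leq_col _).
rewrite sub1 mxrank1 => led; lia.
Qed.

End SliceRank.

(** * Polynomial expansion of the indicator of [a + b + c = 0] *)

Section TrinomialExpansion.
Variable F : comNzRingType.

(** Only the degree bound matters later, so like monomials are left uncollected and no multinomial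
    coefficients appear. *)
Lemma trinomial_expansion N : exists s : seq (F * (nat * nat * nat)),
  all (fun t => t.2.1.1 + t.2.1.2 + t.2.2 <= N)%N s /\
  forall a b c : F, (a + b + c) ^+ N =
    \sum_(t <- s) t.1 * (a ^+ t.2.1.1 * b ^+ t.2.1.2 * c ^+ t.2.2).
Proof.
elim: N => [|N [s [ds sE]]].
  exists [:: (1, (0, 0, 0)%N)]; split=> // a b c.
  by rewrite big_seq1 /= !expr0 !mulr1.
pose sh i j l (t : F * (nat * nat * nat)) :=
  (t.1, (i + t.2.1.1, j + t.2.1.2, l + t.2.2)%N).
exists (map (sh 1 0 0)%N s ++ map (sh 0 1 0)%N s ++ map (sh 0 0 1)%N s); split.
  rewrite !all_cat !all_map; apply/and3P; split; apply: sub_all ds => t /=; lia.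
move=> a b c; rewrite exprS sE !big_cat !big_map /= !mulrDl addrA.
by congr (_ + _ + _); rewrite mulr_sumr; apply: eq_bigr => t _ /=;
   rewrite ?add0n ?exprS; ring.
Qed.

End TrinomialExpansion.

Section Indicator.
Variable F : finFieldType.
Let N := #|F|.-1.

Lemma indicator_expr (x : F) : (x == 0)%:R = 1 - x ^+ N.
Proof.
have NS : N.+1 = #|F| by rewrite prednK // (ltn_trans _ (finNzRing_gt1 F)).
have [->|x0] := eqVneq x 0.
  have N0 : N != 0%N by rewrite -lt0n -ltnS NS finNzRing_gt1.
  by rewrite expr0n (negPf N0) subr0.
apply/eqP; rewrite eq_sym subr_eq0 eq_sym; apply/eqP.
by apply: (mulfI x0); rewrite -exprS NS expf_card mulr1.
Qed.

(** Expand [1 - (a + b + c) ^+ N]. Exponents live in ['I_N.+1] so that exponent vectors form a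
    finite type. *)
Lemma sum3_eq0_expansion : exists (d : nat) (k : 'I_d -> F) (i j l : 'I_d -> 'I_N.+1),
  (forall t, i t + j t + l t <= N)%N /\
  forall a b c : F, (a + b + c == 0)%:R =
    \sum_t k t * (a ^+ i t * b ^+ j t * c ^+ l t).
Proof.
have [s [ds sE]] := trinomial_expansion F N.
pose s' := (1, (0, 0, 0)%N) :: [seq (- t.1, t.2) | t <- s].
have ds' : all (fun t => t.2.1.1 + t.2.1.2 + t.2.2 <= N)%N s'.
  by rewrite /= all_map.
have dn (t : 'I_(size s')) : (let u := tnth (in_tuple s') t in
     u.2.1.1 + u.2.1.2 + u.2.2 <= N)%N.
  by move/allP: ds'; apply; rewrite mem_tnth.
exists (size s'), (fun t => (tnth (in_tuple s') t).1),
  (fun t => inord (tnth (in_tuple s') t).2.1.1),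
  (fun t => inord (tnth (in_tuple s') t).2.1.2),
  (fun t => inord (tnth (in_tuple s') t).2.2); split.
  by move=> t; have /= := dn t => Ht; rewrite !inordK //; lia.
move=> a b c; rewrite indicator_expr sE.
transitivity (\sum_(t <- s') t.1 * (a ^+ t.2.1.1 * b ^+ t.2.1.2 * c ^+ t.2.2)).
  rewrite big_cons /= !expr0 !mulr1 big_map; congr (_ + _).
  by rewrite -sumrN; apply: eq_bigr => t _; rewrite mulNr.
rewrite big_tnth; apply: eq_bigr => t _.
by have /= := dn t => Ht; rewrite !inordK //; lia.
Qed.

End Indicator.

(** * The cap set bound *)

Section CapSet.
Variables (F : finFieldType) (n : nat).
Let N := #|F|.-1.
Let exponent := {ffun 'I_n -> 'I_N.+1}.

Definition monomial (e : exponent) (x : 'rV[F]_n) := \prod_o x 0 o ^+ e o.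
(** Three degrees with total at most [n * N] cannot all exceed a third of it. *)
Definition low_exponents : {set exponent} := [set e : exponent | 3 * \sum_o e o <= n * N]%N.

(** Collecting terms by exponent vector leaves one slice per low exponent, however many terms the
    expansion has. *)
Lemma sum_low_exponents d (i : 'I_d -> 'I_N.+1) (G : {ffun 'I_n -> 'I_d} -> F)
    (P : pred {ffun 'I_n -> 'I_d}) (x : 'rV[F]_n) :
  (forall t, P t -> [ffun o => i (t o)] \in low_exponents) ->
  \sum_(t | P t) monomial [ffun o => i (t o)] x * G t =
  \sum_(a < #|low_exponents|) monomial (enum_val a) x *
     \sum_(t | P t && ([ffun o => i (t o)] == enum_val a :> exponent)) G t.
Proof.
move=> Plow; rewrite (partition_big _ _ Plow) /= big_enum_val.
apply: eq_bigr => a _; rewrite mulr_sumr.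
by apply: eq_bigr => t /andP[_ /eqP ->].
Qed.

(** The tensor testing [c1 x + c2 y + c3 z = 0] on [U] is diagonal: [c0] gives the diagonal
    solutions and freeness excludes all others. The polynomial expansion cuts it into
    [#|low_exponents|] slices of each of three kinds. *)
Lemma sum3_free_bound (U : {set 'rV[F]_n}) (c1 c2 c3 : F) :
  c1 + c2 + c3 = 0 ->
  (forall x y z, x \in U -> y \in U -> z \in U ->
     c1 *: x + c2 *: y + c3 *: z = 0 -> x = y /\ x = z) ->
  (#|U| <= 3 * #|low_exponents|)%N.
Proof.
move=> c0 Ufree.
have [d [k [i [j [l [dle kE]]]]]] := sum3_eq0_expansion F.
pose I (t : {ffun 'I_n -> 'I_d}) : exponent := [ffun o => i (t o)].
pose J (t : {ffun 'I_n -> 'I_d}) : exponent := [ffun o => j (t o)].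
pose L (t : {ffun 'I_n -> 'I_d}) : exponent := [ffun o => l (t o)].
pose K (t : {ffun 'I_n -> 'I_d}) : F := \prod_o k (t o).
pose low := low_exponents.
have someLow t : [|| I t \in low, J t \in low | L t \in low].
  have : (\sum_o (I t o + J t o + L t o) <= n * N)%N.
    apply: (@leq_trans (\sum_(o < n) N)%N).
      by apply: leq_sum => o _; rewrite !ffunE.
    by rewrite sum_nat_const card_ord.
  rewrite !big_split /= /low !inE.
  set x := (\sum_o I _ _)%N; set y := (\sum_o J _ _)%N; set z := (\sum_o L _ _)%N; lia.
have fullE (x y z : 'rV[F]_n) : (x + y + z == 0)%:R =
    \sum_t K t * (monomial (I t) x * monomial (J t) y * monomial (L t) z).
  transitivity (\prod_o (x 0 o + y 0 o + z 0 o == 0)%:R : F).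
    have [/eqP/rowP E|] := boolP (x + y + z == 0).
      by rewrite big1 // => o _; have := E o; rewrite !mxE => ->; rewrite eqxx.
    apply: contraNeq; rewrite eq_sym => nz.
    apply/eqP/rowP => o; rewrite !mxE; apply/eqP; apply: contraNT nz => nz.
    by rewrite (bigD1 o) //= (negPf nz) mul0r.
  under eq_bigr do rewrite kE.
  rewrite bigA_distr_bigA; apply: eq_bigr => t _.
  rewrite /K /monomial -!big_split; apply: eq_bigr => o _ /=.
  by rewrite !ffunE.
(* Each term goes to the first variable in which its degree is low; for [P3] this is the third one,
   by [someLow]. *)
pose P1 t := I t \in low.
pose P2 t := (I t \notin low) && (J t \in low).
pose P3 t := (I t \notin low) && (J t \notin low).
pose u (a : 'I_#|U|) : 'rV[F]_n := enum_val a.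
pose p := \matrix_(a < #|U|, e < #|low|) monomial (enum_val e) (c1 *: u a).
pose q := \matrix_(a < #|U|, e < #|low|) monomial (enum_val e) (c2 *: u a).
pose r := \matrix_(a < #|U|, e < #|low|) monomial (enum_val e) (c3 *: u a).
pose g (e : 'I_#|low|) := \matrix_(y < #|U|, z < #|U|) \sum_(t | P1 t && (I t == enum_val e))
   K t * (monomial (J t) (c2 *: u y) * monomial (L t) (c3 *: u z)).
pose h (e : 'I_#|low|) := \matrix_(x < #|U|, z < #|U|) \sum_(t | P2 t && (J t == enum_val e))
   K t * (monomial (I t) (c1 *: u x) * monomial (L t) (c3 *: u z)).
pose m (e : 'I_#|low|) := \matrix_(x < #|U|, y < #|U|) \sum_(t | P3 t && (L t == enum_val e))
   K t * (monomial (I t) (c1 *: u x) * monomial (J t) (c2 *: u y)).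
apply: (@slice_rank_diagonal F _ _ p q r g h m) => x y z.
have -> : ((x == y) && (x == z)) = (c1 *: u x + c2 *: u y + c3 *: u z == 0).
  apply/andP/eqP => [[/eqP <- /eqP <-]|/Ufree].
    by rewrite -!scalerDl c0 scale0r.
  by case=> [|||/enum_val_inj <- /enum_val_inj <-]; rewrite ?eqxx //; exact: enum_valP.
rewrite fullE (bigID P1) /= -addrA; congr (_ + _).
  transitivity (\sum_(t | P1 t) monomial (I t) (c1 *: u x) *
     (K t * (monomial (J t) (c2 *: u y) * monomial (L t) (c3 *: u z)))).
    by apply: eq_bigr => t _; ring.
  rewrite sum_low_exponents //.
  by apply: eq_bigr => e _; rewrite !mxE.
rewrite (bigID (fun t => J t \in low)) /=; congr (_ + _).
  transitivity (\sum_(t | P2 t) monomial (J t) (c2 *: u y) *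
     (K t * (monomial (I t) (c1 *: u x) * monomial (L t) (c3 *: u z)))).
    by apply: eq_bigr => t _; ring.
  rewrite sum_low_exponents => [|t /andP[] //].
  by apply: eq_bigr => e _; rewrite !mxE.
transitivity (\sum_(t | P3 t) monomial (L t) (c3 *: u z) *
   (K t * (monomial (I t) (c1 *: u x) * monomial (J t) (c2 *: u y)))).
  by apply: eq_bigr => t _; ring.
rewrite sum_low_exponents => [|t /andP[n1 n2]].
  by apply: eq_bigr => e _; rewrite !mxE.
by have := someLow t; rewrite (negPf n1) (negPf n2).
Qed.

End CapSet.

(** * Counts exponentially smaller than [q ^ n] *)

Section Small.
Variables (R : realType) (q : nat).
Hypothesis q_gt1 : (1 < q)%N.

Definition small (f : nat -> nat) :=
  exists b g : R, [/\ 0 <= b, 0 < g, g < q%:R & forall n, (f n)%:R <= b * g ^+ n].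

Lemma small_leq f g : (forall n, f n <= g n)%N -> small g -> small f.
Proof.
move=> le [b [c [b0 c0 cq H]]]; exists b, c; split=> // n.
by apply: le_trans (H n); rewrite ler_nat.
Qed.

Lemma smallD f g : small f -> small g -> small (fun n => f n + g n)%N.
Proof.
move=> [b [c [b0 c0 cq H]]] [b' [c' [b0' c0' cq' H']]].
exists (b + b'), (Num.max c c'); split; rewrite ?addr_ge0 //.
- by rewrite lt_max c0.
- by rewrite gt_max cq.
move=> n; rewrite natrD mulrDl; apply: lerD.
  apply: le_trans (H n) _; apply: ler_wpM2l => //.
  by apply: lerXn2r; rewrite ?nnegrE ?le_max ?lexx ?(ltW c0).
apply: le_trans (H' n) _; apply: ler_wpM2l => //.
by apply: lerXn2r; rewrite ?nnegrE ?le_max ?lexx ?(ltW c0') ?orbT.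
Qed.

Lemma smallM f k : small f -> small (fun n => k * f n)%N.
Proof.
move=> [b [c [b0 c0 cq H]]]; exists (k%:R * b), c; split; rewrite ?mulr_ge0 //.
by move=> n; rewrite natrM -mulrA; apply: ler_wpM2l.
Qed.

Lemma small_cst k : small (fun _ => k).
Proof.
exists k%:R, 1; split=> //; first by rewrite ltr1n.
by move=> n; rewrite expr1n mulr1.
Qed.

End Small.

(** * Low exponents are exponentially few *)

Section LowExponentsSmall.
Variable R : realType.

Lemma exprB1_le (e : R) M : 0 <= e <= 1 -> (1 - e) ^+ M <= 1 - M%:R * e + (M%:R * e) ^+ 2.
Proof.
move=> /andP[e0 e1]; elim: M => [|M IHM]; first by rewrite expr0 mul0r subr0 expr0n addr0.
rewrite exprS.
have : (1 - e) * (1 - e) ^+ M <= (1 - e) * (1 - M%:R * e + (M%:R * e) ^+ 2).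
  by apply: ler_wpM2l => //; lra.
move=> /le_trans; apply; rewrite -natr1.
have M0 : 0 <= M%:R :> R by [].
have : 0 <= M%:R * e * e by rewrite !mulr_ge0.
have : 0 <= (M%:R * e) ^+2 * e by rewrite !mulr_ge0 ?sqr_ge0.
have : 0 <= e * e by rewrite mulr_ge0.
set x := M%:R; nra.
Qed.

Lemma exprB1_ge (e : R) M : 0 <= e <= 1 -> 1 - M%:R * e <= (1 - e) ^+ M.
Proof.
move=> /andP[e0 e1]; elim: M => [|M IHM]; first by rewrite expr0 mul0r subr0.
rewrite exprS; apply: le_trans (_ : (1 - e) * (1 - M%:R * e) <= _).
  have : 0 <= M%:R * e * e by rewrite !mulr_ge0.
  by rewrite -natr1; set x := M%:R; nra.
by apply: ler_wpM2l => //; lra.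
Qed.

(* At [mu = 1] both sides agree, and the derivative there favours [mu < 1]. *)
Lemma tilted_sum_lt N : (0 < N)%N -> exists mu : R, [/\ 0 < mu, mu <= 1 &
  \sum_(i < N.+1) mu ^+ (3 * i) < N.+1%:R * mu ^+ N].
Proof.
move=> N0; have N1 : 1 <= N%:R :> R by rewrite ler1n.
(* With [t = N * e], the proof compares [1 - 3/2 t + 9/2 t ^ 2] with [1 - t], so any positive
   [t < 1/9] works. *)
pose e : R := (36 * N%:R)^-1.
have e0 : 0 < e by rewrite invr_gt0; lra.
have Ne : N%:R * e = 36^-1 by rewrite /e; field; lra.
have e1 : e <= 1 by nra.
have e01 : 0 <= e <= 1 by rewrite ltW.
exists (1 - e); split; [by nra|by lra|].
have : \sum_(i < N.+1) (1 - e) ^+ (3 * i) <=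
    \sum_(i < N.+1) (1 - 3 * e * i%:R + 9 * N%:R * e ^+ 2 * i%:R).
  apply: ler_sum => i _; apply: le_trans (exprB1_le _ e01) _.
  rewrite natrM.
  have iN : (i : nat)%:R <= N%:R :> R by rewrite ler_nat -ltnS.
  have i0 : 0 <= (i : nat)%:R :> R by [].
  have : 0 <= e ^+ 2 * (i%:R * (N%:R - i%:R)).
    by rewrite mulr_ge0 ?sqr_ge0 // mulr_ge0 // subr_ge0.
  set x := (i : nat)%:R; nra.
move=> /le_lt_trans; apply.
have -> : \sum_(i < N.+1) (1 - 3 * e * i%:R + 9 * N%:R * e ^+ 2 * i%:R) =
   N.+1%:R - 3 * e * (\sum_(i < N.+1) i)%:R + 9 * N%:R * e ^+ 2 * (\sum_(i < N.+1) i)%:R.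
  rewrite !big_split /= sumr_const card_ord sumrN -!mulr_sumr -natr_sum.
  by [].
have sumE : (\sum_(i < N.+1) i)%:R = N.+1%:R * N%:R / 2 :> R.
  have : (2 * \sum_(i < N.+1) i = N.+1 * N)%N.
    elim: (N) => [|M IH]; first by rewrite big_ord_recr big_ord0.
    by rewrite big_ord_recr /= mulnDr IH; lia.
  by move=> /(congr1 (fun x => x%:R : R)); rewrite !natrM => H; lra.
rewrite sumE.
have : N.+1%:R * (1 - N%:R * e) <= N.+1%:R * (1 - e) ^+ N.
  by apply: ler_wpM2l => //; exact: exprB1_ge.
apply: lt_le_trans.
have -> : N.+1%:R - 3 * e * (N.+1%:R * N%:R / 2) +
   9 * N%:R * e ^+ 2 * (N.+1%:R * N%:R / 2) =
   N.+1%:R * (1 - 3 / 2 * (N%:R * e) + 9 / 2 * (N%:R * e) ^+ 2) by field.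
by rewrite Ne ltr_pM2l ?ltr0n //; lra.
Qed.

(** Rankin's trick: since [mu <= 1], every low exponent has weight [mu ^+ (3 * degree)] at least
    [mu ^+ (n * N)]. The weights of all exponents sum to [sigma ^+ n], whence the base
    [sigma / mu ^+ N]. *)
Lemma small_low_exponents (F : finFieldType) :
  small R #|F| (fun n => #|low_exponents F n|).
Proof.
have N0 : (0 < #|F|.-1)%N by rewrite -subn1 subn_gt0 finNzRing_gt1.
have [mu [mu0 mu1 muE]] := tilted_sum_lt N0.
set N := #|F|.-1 in N0 muE; have NS : N.+1 = #|F| by rewrite prednK // (ltn_trans _ (finNzRing_gt1 F)).
pose sigma := \sum_(i < N.+1) mu ^+ (3 * i).
exists 1, (sigma / mu ^+ N); split=> //.
- rewrite divr_gt0 ?exprn_gt0 // /sigma big_ord_recl muln0 expr0.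
  by rewrite ltr_pwDl // sumr_ge0 // => i _; rewrite exprn_ge0 // ltW.
- by rewrite ltr_pdivrMr ?exprn_gt0 // -NS.
move=> n; rewrite mul1r expr_div_n ler_pdivlMr ?exprn_gt0 ?exprn_gt0 //.
rewrite -exprM [in X in _ <= X]/sigma -[n in X in _ <= X](card_ord n) -prodr_const.
rewrite bigA_distr_bigA /= mulr_natl -sumr_const.
rewrite [X in _ <= X](bigID (mem (low_exponents F n))) /=.
apply: ler_wpDr; first by apply: sumr_ge0 => e _; apply: prodr_ge0 => o _; rewrite exprn_ge0 // ltW.
apply: ler_sum => e; rewrite inE => le; rewrite prodrXr.
rewrite -/N in le.
by rewrite -big_distrr /= mulnC; apply: ler_wiXn2l => //; exact: ltW.
Qed.

End LowExponentsSmall.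

(** * Robust representations *)

(** Read [B] as a digraph of out-degree at most [K]. By averaging, some vertex has in-degree at most
    [K]; keep it, discard its neighbours in both directions and recurse. *)
Lemma exists_independent_subset (T : finType) (K : nat) (B : T -> {set T}) (U : {set T}) :
  {in U, forall u, #|B u| <= K}%N ->
  exists U' : {set T}, [/\ U' \subset U, (#|U| <= (2 * K).+1 * #|U'|)%N &
    {in U' &, forall u v, v \in B u -> v = u}].
Proof.
have [m] := ubnP #|U|; elim: m => // m IHm in U *; rewrite ltnS => Um BK.
have [->|U0] := eqVneq U set0.
  by exists set0; split=> [||u v]; rewrite ?cards0 ?muln0 ?sub0set ?inE.
have [v vU vK] : exists2 v, v \in U & (#|[set u in U | v \in B u]| <= K)%N.
  apply/exists_inP; apply: contraT; rewrite negb_exists_in => /forall_inP big.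
  have : (\sum_(v in U) K.+1 <= \sum_(u in U) K)%N.
    apply: (@leq_trans (\sum_(v in U) #|[set u in U | v \in B u]|)).
      by apply: leq_sum => v vU; rewrite ltnNge big.
    under eq_bigr do rewrite -sum1_card.
    rewrite (exchange_big_dep (mem U)) /=; last by move=> v u _; rewrite inE => /andP[].
    apply: leq_sum => u uU; rewrite sum1_card.
    apply: leq_trans (BK u uU); apply: subset_leq_card; apply/subsetP => v.
    by rewrite unfold_in /= inE => /and3P[].
  by rewrite !sum_nat_const leq_pmul2l ?ltnn // card_gt0.
pose W := v |: (B v :|: [set u in U | v \in B u]).
have WK : (#|W| <= (2 * K).+1)%N.
  have [+ _] := leq_card_setU (B v) [set u in U | v \in B u].
  have [+ _] := leq_card_setU [set v] (B v :|: [set u in U | v \in B u]).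
  by rewrite cards1 -/W; have := BK v vU; lia.
have leU : (#|U| <= #|U :\: W| + (2 * K).+1)%N.
  rewrite -(cardsID W U) addnC leq_add2l (leq_trans _ WK) // subset_leq_card //.
  exact: subsetIr.
have [||U' [sU' cU' indU']] := IHm (U :\: W).
- apply: leq_trans Um; apply: proper_card; apply/properP; split; first exact: subsetDl.
  by exists v => //; rewrite !inE eqxx.
- by move=> u /setDP[uU _]; exact: BK.
have vU' : v \notin U' by apply/negP => /(subsetP sU'); rewrite !inE eqxx.
exists (v |: U'); split.
- rewrite subUset sub1set vU; apply: subset_trans sU' _; exact: subsetDl.
- by rewrite cardsU1 vU' mulnDr muln1 addnC; apply: leq_trans leU _; rewrite leq_add2r.
move=> x y /setU1P[->|xU'] /setU1P[->|yU'] //; last exact: indU'.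
- by move=> yB; have := subsetP sU' _ yU'; rewrite !inE yB orbT.
- by move=> vB; have /setDP[xU] := subsetP sU' _ xU'; rewrite !inE vB xU !orbT.
Qed.

Section Rich.
Variables (F : finFieldType) (I : finType).

Section Placement.
Variable n : nat.
Implicit Types (S B X : {set 'rV[F]_n}) (G : {set I}) (x : I -> 'rV[F]_n).

Definition places S B G x :=
  {in G, forall j, x j \in S :\: B} /\ {in G &, injective x}.

Definition glue G x y j : 'rV[F]_n := if j \in G then x j else y j.

Lemma places_glue S B G1 G2 x y :
  places S B G1 x -> places S (B :|: x @: G1) G2 y ->
  places S B (G1 :|: G2) (glue G1 x y).
Proof.
move=> [xS xinj] [yS yinj]; split.
  move=> j; rewrite /glue inE; case: ifP => [/xS //|_ /= /yS].
  by rewrite !inE negb_or -andbA => /and3P[-> _ ->].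
have no i j : i \in G1 -> j \in G2 -> x i = y j -> False.
  move=> iG /yS; rewrite !inE negb_or => /andP[/andP[_ /negP H] _] E.
  by apply: H; rewrite -E imset_f.
move=> i j; rewrite /glue !inE; case: ifP => iG; case: ifP => jG /= iG2 jG2.
- exact: xinj.
- by move=> E; case: (no i j).
- by move=> E; case: (no j i).
- exact: yinj.
Qed.

Lemma sum_glue (W : zmodType) (h : I -> 'rV[F]_n -> W) G1 G2 x y :
  [disjoint G1 & G2] ->
  \sum_(j in G1 :|: G2) h j (glue G1 x y j) =
  \sum_(j in G1) h j (x j) + \sum_(j in G2) h j (y j).
Proof.
move=> dis; rewrite (eq_bigl [predU G1 & G2]); last by move=> j; rewrite !inE.
rewrite bigU //=; congr (_ + _); apply: eq_bigr => j jG; rewrite /glue.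
  by rewrite jG.
by rewrite (disjointFl dis jG).
Qed.

End Placement.

Variables (L : nat) (c : I -> F).
Implicit Types G T : {set I}.

(* Representability of [w] by distinct points that survives deleting any set of points disjoint
   from [X], as long as at most [L] points are used or deleted. *)
Definition rich n (S X : {set 'rV[F]_n}) (G : {set I}) (w : 'rV[F]_n) :=
  [forall B : {set 'rV[F]_n}, [disjoint B & X] && (#|B| + #|G| <= L)%N ==>
    [exists x : {ffun I -> 'rV[F]_n}, [&& [forall j in G, x j \in S :\: B],
       dinjectiveb x G & \sum_(j in G) c j *: x j == w]]].

Lemma richP n (S X : {set 'rV[F]_n}) G w :
  reflect (forall B : {set 'rV[F]_n}, [disjoint B & X] -> (#|B| + #|G| <= L)%N ->
     exists2 x, places S B G x & \sum_(j in G) c j *: x j = w)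
  (rich S X G w).
Proof.
apply: (iffP forallP) => H B.
  move=> dB cB; have := H B; rewrite dB cB => /existsP[x /and3P[/forall_inP xS /dinjectiveP xi /eqP xE]].
  by exists x.
apply/implyP => /andP[dB cB]; have [x [xS xi] xE] := H B dB cB.
apply/existsP; exists [ffun j => x j]; apply/and3P; split.
- by apply/forall_inP => j jG; rewrite ffunE xS.
- by apply/dinjectiveP => i j iG jG; rewrite !ffunE; exact: xi.
- by rewrite -xE; apply/eqP; apply: eq_bigr => j _; rewrite ffunE.
Qed.

Lemma rich0P n (S : {set 'rV[F]_n}) G w :
  reflect (forall B : {set 'rV[F]_n}, (#|B| + #|G| <= L)%N ->
     exists2 x, places S B G x & \sum_(j in G) c j *: x j = w)
  (rich S set0 G w).
Proof.
apply: (iffP (richP _ _ _ _)) => H B; last by move=> _; exact: H.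
by apply: H; rewrite -setI_eq0 setI0.
Qed.

Lemma rich_protect n (S X : {set 'rV[F]_n}) G w : rich S set0 G w -> rich S X G w.
Proof. by move=> /rich0P H; apply/richP => B _; exact: H. Qed.

(** Points placed on [G1] become deleted points for [G2] within the same budget; this is why
    richness bounds [#|B| + #|G|]. *)
Lemma leq_card_glue n (B : {set 'rV[F]_n}) (G1 G2 : {set I}) x :
  [disjoint G1 & G2] -> (#|B| + #|G1 :|: G2| <= L)%N ->
  (#|B :|: x @: G1| + #|G2| <= L)%N.
Proof.
move=> dis; rewrite cardsU (disjoint_setI0 dis) cards0 subn0.
have cB : (#|B :|: x @: G1| <= #|B| + #|G1|)%N.
  apply: leq_trans (leq_card_setU _ _).1 _; rewrite leq_add2l; exact: leq_imset_card.
by rewrite addnA; apply: leq_trans; rewrite leq_add2r.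
Qed.

(** Place [G1] first and delete its points before placing [G2], so the two placements cannot
    collide. *)
Lemma richD n (S : {set 'rV[F]_n}) G1 G2 w1 w2 : [disjoint G1 & G2] ->
  rich S set0 G1 w1 -> rich S set0 G2 w2 -> rich S set0 (G1 :|: G2) (w1 + w2).
Proof.
move=> dis /rich0P r1 /rich0P r2; apply/rich0P => B cB.
have cB1 : (#|B| + #|G1| <= L)%N.
  by apply: leq_trans cB; rewrite leq_add2l subset_leq_card // subsetUl.
have [x px xE] := r1 B cB1.
have [y py yE] := r2 _ (leq_card_glue x dis cB).
exists (glue G1 x y); first exact: places_glue.
by rewrite (sum_glue (fun j v => c j *: v)) // xE yE.
Qed.

Variable R : realType.
Local Notation small := (small R #|F|).

(** A point [u] is poor if the value obtained by putting all of [G] at [u] is not rich. With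
    [protect], [u] itself may not be deleted, which makes singletons usable in the induction. *)
Definition few_poor (protect : bool) (G : {set I}) :=
  exists2 f, small f & forall n (S U : {set 'rV[F]_n}), U \subset S ->
    {in U, forall u, ~~ rich S (if protect then [set u] else set0) G ((\sum_(j in G) c j) *: u)} ->
    (#|U| <= f n)%N.

(* The [T]-coordinates together with one further point solve a short equation; the further point
   is then split along [G :\: T]. *)
Lemma few_poor_step (G T : {set I}) f0 : T \subset G -> small f0 ->
  few_poor true (G :\: T) ->
  (forall n (U : {set 'rV[F]_n}),
     (forall (y : I -> 'rV[F]_n) x u, {in T &, injective y} ->
        {in T, forall j, [/\ y j \in U, y j != x & y j != u]} ->
        x \in U -> u \in U -> x != u ->
        \sum_(j in T) c j *: y j + (\sum_(j in G :\: T) c j) *: x =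
          (\sum_(j in G) c j) *: u -> False) ->
     (#|U| <= f0 n)%N) ->
  few_poor false G.
Proof.
move=> TG sf0 [f' sf' poor'] base.
exists (fun n => f' n + (2 * L).+1 * f0 n)%N; first exact: smallD (smallM _ _).
move=> n S U US poor.
pose e' := \sum_(j in G :\: T) c j; pose e := \sum_(j in G) c j.
pose W := [set u in U | rich S [set u] (G :\: T) (e' *: u)].
rewrite -(cardsID W U) addnC; apply: leq_add.
  apply: (poor' n S); first by apply: subset_trans US; exact: subsetDl.
  by move=> u; rewrite !inE => /andP[+ uU]; rewrite uU.
have -> : U :&: W = W by apply/setIidPr; apply/subsetP => u; rewrite inE => /andP[].
have WU u : u \in W -> u \in U by rewrite inE => /andP[].
pose bad u (B : {set 'rV[F]_n}) := (#|B| + #|G| <= L)%N &&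
   [forall x : {ffun I -> 'rV[F]_n}, ~~ [&& [forall j in G, x j \in S :\: B],
       dinjectiveb x G & \sum_(j in G) c j *: x j == e *: u]].
(* A deleted set witnessing that [u] is poor; the default is never reached for [u \in W]. Below, no
   point of [V] lies in the witness of another one. *)
pose B u := odflt set0 [pick B | bad u B].
have badB u : u \in W -> bad u (B u).
  move=> /WU /poor; rewrite negb_forall => /existsP[B0].
  rewrite negb_imply -andbA negb_exists => /and3P[_ B0L /forallP B0x].
  rewrite /B; case: pickP => //= /(_ B0); rewrite /bad B0L /=.
  by move/negbT; rewrite negb_forall => /existsP[x]; rewrite negbK => xx; have := B0x x; rewrite xx.
have cB : {in W, forall u, #|B u| <= L}%N.
  by move=> u /badB /andP[+ _]; apply: leq_trans; exact: leq_addr.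
have [V [VW cV indV]] := exists_independent_subset cB.
apply: leq_trans cV _; rewrite leq_mul2l; apply/orP; right.
apply: base => y x u yinj yV xV uV xu E.
have uW := subsetP VW u uV; have xW := subsetP VW x xV.
have /andP[cBu /forallP notx] := badB u uW.
have VS v : v \in V -> v \in S by move=> /(subsetP VW) /WU /(subsetP US).
have disT : [disjoint T & G :\: T].
  by rewrite -setI_eq0; apply/eqP/setP => j; rewrite !inE; case: (j \in T).
have GE : T :|: (G :\: T) = G by rewrite -{1}(setIidPr TG) setID.
have py : places S (B u) T y.
  split=> // j /yV[yjV _ yju]; rewrite inE VS // andbT.
  by apply: contra yju => H; rewrite (indV u (y j)).
have : rich S [set x] (G :\: T) (e' *: x) by move: xW; rewrite inE => /andP[].
(* The protected point [x] is neither in [B u], by independence, nor among the [y j]. Hence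
   [G :\: T] can be spread out from [x], against the choice of [B u]. *)
move/richP => /(_ (B u :|: y @: T)) [||z pz zE].
- rewrite disjoint_sym disjoints1 inE negb_or; apply/andP; split.
    by apply: contra xu => H; rewrite (indV u x).
  by apply/imsetP => -[j /yV[_ yx _] xy]; rewrite -xy eqxx in yx.
- by apply: leq_card_glue => //; rewrite GE.
have [gS ginj] := places_glue py pz; rewrite GE in gS ginj.
have := notx [ffun j => glue T y z j]; case/negP; apply/and3P; split.
- by apply/forall_inP => j jG; rewrite ffunE gS.
- by apply/dinjectiveP => i j iG jG; rewrite !ffunE; exact: ginj.
- under eq_bigr do rewrite ffunE.
  by rewrite -{1}GE (sum_glue (fun j v => c j *: v)) // zE E.
Qed.

Lemma few_poor_protect1 j : few_poor true [set j].
Proof.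
exists (fun _ => 0)%N; first exact: small_cst (finNzRing_gt1 F) _.
move=> n S U US poor; rewrite leqn0 cards_eq0; apply/eqP/setP => u; rewrite [RHS]inE.
apply/negP => uU; case/negP: (poor u uU); apply/richP => B dB _.
exists (fun=> u); last by rewrite !big_set1.
split=> [i _|i i' /set1P -> /set1P ->//].
by rewrite inE (subsetP US) // andbT; move: dB; rewrite disjoint_sym disjoints1.
Qed.

Lemma few_poorW G : few_poor false G -> few_poor true G.
Proof.
move=> [f sf H]; exists f => // n S U US poor; apply: (H n S U US) => u uU.
by apply: contra (poor u uU); exact: rich_protect.
Qed.

End Rich.

(** * Poor points are few, by cap set and Sidon bounds *)

Section FewPoor.
Variables (R : realType) (F : finFieldType).
Local Notation small := (small R #|F|).

(** As all three coefficients are nonzero, a solution with two equal points has all three equal. *)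
Lemma sum3_distinct_free_bound n (U : {set 'rV[F]_n}) (c1 c2 : F) :
  c1 != 0 -> c2 != 0 -> c1 + c2 != 0 ->
  (forall y x u, y \in U -> x \in U -> u \in U -> y != x -> y != u -> x != u ->
     c1 *: y + c2 *: x = (c1 + c2) *: u -> False) ->
  (#|U| <= 3 * #|low_exponents F n|)%N.
Proof.
move=> c1n c2n cn Ufree.
apply: (@sum3_free_bound F n U c1 c2 (- (c1 + c2))); first by rewrite subrr.
move=> y x u yU xU uU; rewrite scaleNr => /eqP; rewrite subr_eq0 => /eqP E.
have inj (a : F) (v w : 'rV[F]_n) : a != 0 -> a *: v = a *: w -> v = w.
  by move=> a0 /(congr1 (fun v => a^-1 *: v)); rewrite !scalerA mulVf // !scale1r.
have [yx|yx] := eqVneq y x.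
  by subst x; move: E; rewrite -scalerDl => /inj ->.
have [yu|yu] := eqVneq y u.
  subst u; move: E; rewrite scalerDl => /addrI /inj xy.
  by rewrite xy ?eqxx in yx.
have [xu|xu] := eqVneq x u.
  subst u; move: E; rewrite scalerDl => /addIr /inj xy.
  by rewrite xy ?eqxx in yx.
by have := Ufree y x u yU xU uU yx yu xu E.
Qed.

(** Count ordered pairs of distinct points by their sum: each sum comes from at most [(a, b)] and
    [(b, a)], which gives [2 q ^ n] pairs, and the diagonal adds at most [q ^ n]. *)
Lemma sidon_bound n (U : {set 'rV[F]_n}) :
  (forall a b x u, a \in U -> b \in U -> x \in U -> u \in U ->
     a != b -> a != x -> a != u -> b != x -> b != u -> x != u -> a + b = x + u -> False) ->
  (#|U| * #|U| <= 3 * #|F| ^ n)%N.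
Proof.
move=> Ufree; pose D := [set p in setX U U | p.1 != p.2].
have cV : #|{: 'rV[F]_n}| = (#|F| ^ n)%N by rewrite card_mx mul1n.
have cD : (#|D| <= 2 * #|F| ^ n)%N.
  rewrite -sum1_card (partition_big (fun p => p.1 + p.2) xpredT) //=.
  apply: (@leq_trans (\sum_(w : 'rV[F]_n) 2)); last by rewrite sum_nat_const cV mulnC.
  apply: leq_sum => w _; rewrite sum1dep_card.
  have [->|[[a b]]] := set_0Vmem [set p in D | p.1 + p.2 == w]; first by rewrite cards0.
  rewrite !inE /= -!andbA => /and4P[aU bU ab /eqP abw].
  apply: (@leq_trans #|[set (a, b); (b, a)]|); last by rewrite cards2; case: (_ != _).
  apply/subset_leq_card/subsetP => -[x u]; rewrite !inE /= -!andbA.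
  case/and4P => xU uU xu /eqP xuw; rewrite !xpair_eqE.
  have E : a + b = x + u by rewrite abw.
  have [Eax|ax] := eqVneq x a.
    by subst x; move/addrI: E => ->; rewrite eqxx.
  have [Ebx|bx] := eqVneq x b.
    by subst x; move: E; rewrite addrC => /addrI ->; rewrite eqxx orbT.
  have [Eau|au] := eqVneq a u.
    by subst u; move: E; rewrite [RHS]addrC => /addrI Eb; rewrite Eb eqxx in bx.
  have [Ebu|bu] := eqVneq b u.
    by subst u; move: E => /addIr Eb; rewrite Eb eqxx in ax.
  by case: (Ufree a b x u) => //; rewrite eq_sym.
have : (#|setX U U| <= #|D| + #|U|)%N.
  rewrite -(cardsID D (setX U U)) leq_add //.
    by rewrite subset_leq_card // subsetIr.
  rewrite -(card_imset (mem U) (f := fun u => (u, u))); last by move=> u v [].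
  apply: subset_leq_card; apply/subsetP => -[a b]; rewrite !inE /= -andbA.
  by move=> /and3P[+ aU bU]; rewrite aU bU /= negbK => /eqP <-; exact: imset_f.
rewrite cardsX => le; apply: leq_trans le _.
have : (#|U| <= #|F| ^ n)%N by rewrite -cV max_card.
by lia.
Qed.

Lemma small_sidon : exists2 f, small f & forall n (N : nat),
  (N * N <= 3 * #|F| ^ n)%N -> (N <= f n)%N.
Proof.
have q1 : 1 < #|F|%:R :> R by rewrite ltr1n finNzRing_gt1.
pose f n := \max_(N < (3 * #|F| ^ n).+1 | (N * N <= 3 * #|F| ^ n)%N) N.
exists f; last first.
  move=> n N le; have lN : (N < (3 * #|F| ^ n).+1)%N.
    by rewrite ltnS; apply: leq_trans le; case: (N) => // M; rewrite leq_pmull.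
  exact: (@leq_bigmax_cond _ (fun N : 'I__ => (N * N <= 3 * #|F| ^ n)%N) _ (Ordinal lN)).
exists 2, (Num.sqrt #|F|%:R); split=> //.
- by rewrite sqrtr_gt0; lra.
- have s1 : 1 < Num.sqrt #|F|%:R :> R by rewrite -[X in X < _]sqrtr1 ltr_sqrt ?(lt_trans ltr01 q1).
  rewrite -[X in _ < X]sqr_sqrtr ?ler0n // expr2.
  by rewrite ltr_pMr //; lra.
move=> n; have : (f n * f n <= 3 * #|F| ^ n)%N.
  by rewrite /f; elim/big_ind: _ => // x y; case: (leqP x y).
rewrite -(ler_nat R) !natrM natrX => le.
have s0 : 0 <= Num.sqrt #|F|%:R ^+ n :> R by rewrite exprn_ge0 ?sqrtr_ge0.
have sE : (Num.sqrt #|F|%:R ^+ n) ^+ 2 = #|F|%:R ^+ n :> R.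
  by rewrite exprAC sqr_sqrtr ?ler0n.
rewrite -ler_sqr ?nnegrE ?mulr_ge0 //.
have q0 : 0 <= #|F|%:R ^+ n :> R by rewrite exprn_ge0 ?ler0n.
rewrite exprMn sE; set Q := _ ^+ n in le q0 *; nra.
Qed.

Variables (I : finType) (L : nat) (c : I -> F).

(** Induction on [#|G|] through [few_poor_step]: one or two columns are split off so that the
    remaining coefficients have nonzero sum. A single remaining column is covered by protection. *)
Lemma few_poor_main (G : {set I}) : (1 < #|G|)%N ->
  {in G, forall j, c j != 0} -> \sum_(j in G) c j != 0 -> few_poor L c R false G.
Proof.
have [m] := ubnP #|G|; elim: m => // m IHm in G *; rewrite ltnS => Gm G1 c0 e0.
have rec (T : {set I}) : T \subset G -> T != set0 -> \sum_(j in G :\: T) c j != 0 ->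
    few_poor L c R true (G :\: T).
  move=> TG T0 e'0.
  have lt : (#|G :\: T| < m)%N.
    apply: leq_trans Gm; apply: proper_card.
    rewrite properEneq subsetDl andbT; apply: contra T0 => /eqP E.
    rewrite -subset0; apply/subsetP => j jT; have := subsetP TG j jT.
    by rewrite -E !inE jT.
  have [le1|gt1] := leqP #|G :\: T| 1; last first.
    by apply: few_poorW; apply: IHm => // j /setDP[jG _]; exact: c0.
  have : #|G :\: T| == 1%N.
    rewrite eqn_leq le1 card_gt0; apply: contra e'0 => /eqP ->.
    by rewrite big_set0.
  by case/cards1P => j ->; exact: few_poor_protect1.
set e := \sum_(j in G) c j.
(* A coefficient different from [e] can be split off alone; the short equation is then of cap set
   type. *)
have [/exists_inP[j0 j0G c0e]|] := boolP [exists j in G, c j != e].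
  have TG : [set j0] \subset G by rewrite sub1set.
  have eD : e = c j0 + \sum_(j in G :\: [set j0]) c j by rewrite /e (big_setD1 j0).
  have e'0 : \sum_(j in G :\: [set j0]) c j != 0.
    by apply: contra c0e => /eqP E; rewrite eD E addr0.
  apply: (few_poor_step TG (smallM 3 (small_low_exponents R F))).
    apply: rec => //; apply/set0Pn; exists j0; exact: set11.
  move=> n U Ufree.
  apply: (@sum3_distinct_free_bound n U (c j0) (\sum_(j in G :\: [set j0]) c j)) => //.
  - exact: c0.
  - by rewrite -eD.
  move=> y x u yU xU uU yx yu xu E; apply: (Ufree (fun=> y) x u) => //.
  - by move=> i j /set1P -> /set1P ->.
  - by rewrite big_set1 E -eD.
rewrite negb_exists_in => /forall_inP ce.
have {}ce j : j \in G -> c j = e by move=> /ce; rewrite negbK => /eqP.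
have [j0 j0G] : exists j, j \in G by apply/set0Pn; rewrite -card_gt0; lia.
have [j1 j1G] : exists j, j \in G :\ j0.
  by apply/set0Pn; rewrite -card_gt0; have := cardsD1 j0 G; rewrite j0G; lia.
have [j10 j1G'] : j1 != j0 /\ j1 \in G by move: j1G; rewrite !inE => /andP[].
(* All coefficients equal [e], so splitting off one would leave sum 0. Splitting off two leaves
   [- e], and the short equation becomes the Sidon equation [a + b = x + u]. *)
pose T := [set j0; j1].
have TG : T \subset G by rewrite subUset !sub1set j0G.
have sumT (V : zmodType) (h : I -> V) : \sum_(j in T) h j = h j0 + h j1.
  by rewrite /T big_setU1 ?big_set1 // inE eq_sym.
have e'E : \sum_(j in G :\: T) c j = - e.
  have : e = \sum_(j in T) c j + \sum_(j in G :\: T) c j.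
    by rewrite /e (big_setID T) /= (setIidPr TG).
  rewrite sumT !ce // -addrA -[X in X = _]addr0 => /addrI /esym /eqP.
  by rewrite addrC addr_eq0 => /eqP.
have [f sf fP] := small_sidon.
apply: (few_poor_step TG sf).
  by apply: rec => //; [apply/set0Pn; exists j0; rewrite !inE eqxx|rewrite e'E oppr_eq0].
move=> n U Ufree; apply: fP; apply: sidon_bound => a b x u aU bU xU uU ab ax au bx bu xu E.
apply: (Ufree (fun j => if j == j0 then a else b) x u) => //.
- move=> i j /set2P[]-> /set2P[]->; rewrite ?eqxx ?(negPf j10) // => H.
    by rewrite H eqxx in ab.
  by rewrite H eqxx in ab.
- by move=> j _; case: ifP.
rewrite sumT eqxx (negPf j10) !ce // e'E -/e scaleNr -scalerDr E.
by rewrite -scalerBr addrAC subrr add0r.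
Qed.

End FewPoor.

(** * Exceptional solutions of the collapsed system *)

(** For a right inverse [P] of [N], the map sending [(U, V)] to [U + P V] is injective on the fibre
    times all [V], since multiplying by [N] recovers [V]. *)
Lemma card_mulmx_fiber (F : finFieldType) h K n (N : 'M[F]_(h, K)) (W : 'M[F]_(h, n)) :
  row_free N -> (#|[set U : 'M[F]_(K, n) | N *m U == W]| * #|F| ^ (h * n) <= #|F| ^ (K * n))%N.
Proof.
move=> freeN; have [P NP] : exists P, N *m P = 1%:M.
  by exists (pinvmx N); exact: mulmxVp.
rewrite -!card_mx -cardsT -cardsX.
pose f (p : 'M[F]_(K, n) * 'M[F]_(h, n)) := p.1 + P *m p.2.
rewrite -(card_in_imset (f := f)); first exact: max_card.
move=> [U V] [U' V']; rewrite !inE !andbT /= => /eqP UW /eqP UW' E.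
have /addrI VV : W + V = W + V'.
  have := congr1 (mulmx N) E; rewrite /f /= !mulmxDr !mulmxA UW UW'.
  by rewrite NP !mul1mx.
by move: E; rewrite /f /= VV => /addIr ->.
Qed.

Section Rare.
Variables (R : realType) (F : finFieldType) (m K : nat) (M : 'M[F]_(m, K)).
Hypothesis M_weight : forall y : 'rV[F]_m, y != 0 -> (3 < #|[set a | ((y *m M) ord0 a != 0)%R]|)%N.
Local Notation small := (small R #|F|).
Local Notation event := (forall n, {set 'rV[F]_n} -> {set 'M[F]_(K, n)}).

Definition solutions n (S : {set 'rV[F]_n}) :=
  [set U : 'M[F]_(K, n) | (M *m U == 0) && [forall a, row a U \in S]].

(** A combination of rows of [M] that equals one of rows of [N] lives on at most three columns, so
    it vanishes by [M_weight]. The stacked rows are thus independent and each costs a factor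
    [q ^ n]. *)
Lemma card_stack_fiber n h (N : 'M[F]_(h, K)) (Q : {set 'I_K}) (W : 'M[F]_(h, n)) :
  (#|Q| <= 3)%N -> (forall i a, N i a != 0 -> a \in Q) -> row_free N ->
  (#|[set U : 'M[F]_(K, n) | (M *m U == 0)%R && (N *m U == W)]| * #|F| ^ ((m + h) * n)
     <= #|F| ^ (K * n))%N.
Proof.
move=> Q3 NQ freeN.
have freeMN : row_free (col_mx M N).
  apply: inj_row_free => v; rewrite -[v]hsubmxK mul_row_col => /eqP.
  rewrite addr_eq0 => /eqP E.
  have v1 : lsubmx v = 0.
    apply/eqP; apply: contraT => /M_weight; rewrite ltnNge; case/negP.
    apply: leq_trans Q3; apply/subset_leq_card/subsetP => a.
    rewrite inE E mxE oppr_eq0 => nz; apply: contraT => aQ; case/eqP: nz.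
    rewrite mxE big1 // => i _; apply/eqP; rewrite mulf_eq0; apply/orP; right.
    by apply: contraNT aQ; exact: NQ.
  move: E; rewrite v1 mul0mx => /esym/eqP; rewrite oppr_eq0 => /eqP E.
  by rewrite (row_free_inj freeN (_ : rsubmx v *m N = 0 *m N)) ?mul0mx // row_mx0.
have := card_mulmx_fiber (col_mx 0 W) freeMN; apply: leq_trans; rewrite leq_mul2r.
apply/orP; right; apply/subset_leq_card/subsetP => U.
by rewrite !inE mul_col_mx => /andP[/eqP -> /eqP ->].
Qed.

(** The event holds for a fraction at most [g n / q ^ n] of the [q ^ ((K - m) n)] solutions over the
    whole space. *)
Definition rare (E : event) := exists2 g, small g & forall n (S : {set 'rV[F]_n}),
  (#|solutions S :&: E n S| * #|F| ^ (m.+1 * n) <= g n * #|F| ^ (K * n))%N.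

Lemma rareS (E E' : event) :
  (forall n S U, U \in solutions S -> U \in E n S -> U \in E' n S) -> rare E' -> rare E.
Proof.
move=> sub [g sg H]; exists g => // n S; apply: leq_trans (H n S).
rewrite leq_mul2r; apply/orP; right; apply/subset_leq_card/subsetP => U.
by rewrite !inE => /andP[US UE]; rewrite US; apply: sub; rewrite ?inE.
Qed.

Lemma rare0 : rare (fun n S => set0).
Proof.
exists (fun=> 0)%N; first exact: small_cst (finNzRing_gt1 F) _.
by move=> n S; rewrite setI0 cards0.
Qed.

Lemma rareU (E1 E2 : event) : rare E1 -> rare E2 -> rare (fun n S => E1 n S :|: E2 n S).
Proof.
move=> [g1 s1 H1] [g2 s2 H2]; exists (fun n => g1 n + g2 n)%N; first exact: smallD.
move=> n S; rewrite mulnDl; apply: leq_trans (leq_add (H1 n S) (H2 n S)).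
rewrite -mulnDl leq_mul2r setIUr; apply/orP; right; exact: (leq_card_setU _ _).1.
Qed.

Lemma rare_bigcup (T : finType) (P : pred T) (E : T -> event) :
  (forall t, P t -> rare (E t)) -> rare (fun n S => \bigcup_(t | P t) E t n S).
Proof.
move=> rE; suff H (s : seq T) : rare (fun n S => \bigcup_(t <- s | P t) E t n S) by exact: H.
elim: s => [|t s IHs].
  by apply: rareS rare0 => n S U _; rewrite big_nil.
have [Pt|nPt] := boolP (P t).
  by apply: rareS (rareU (rE t Pt) IHs) => n S U _; rewrite big_cons Pt.
by apply: rareS IHs => n S U _; rewrite big_cons (negPf nPt).
Qed.

Lemma rare_row_in a f (T : forall n, {set 'rV[F]_n} -> {set 'rV[F]_n}) :
  small f -> (forall n S, #|T n S| <= f n)%N ->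
  rare (fun n S => [set U | row a U \in T n S]).
Proof.
move=> sf Tf; exists f => // n S.
apply: (@leq_trans (\sum_(t in T n S) #|F| ^ (K * n))); last first.
  by rewrite sum_nat_const leq_mul2r Tf orbT.
rewrite -sum1_card big_distrl /= (partition_big (row a) (mem (T n S))) /=; last first.
  by move=> U; rewrite !inE => /andP[].
apply: leq_sum => t _; rewrite -big_distrl /= sum1dep_card.
have fr : row_free (delta_mx 0 a : 'rV[F]_K) by rewrite /row_free mxrank_delta.
have := @card_stack_fiber n 1 (delta_mx 0 a) [set a] t _ _ fr.
rewrite addn1 cards1 => H; apply: leq_trans (H isT _); last first.
  by move=> i b; rewrite mxE inE => nz; apply: contraNT nz => /negPf ->; rewrite andbF.
rewrite leq_mul2r; apply/orP; right; apply/subset_leq_card/subsetP => U.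
by rewrite !inE -rowE => /andP[/andP[/andP[-> _] _] ->].
Qed.

Lemma rare_row_eq a b : a != b -> rare (fun n S => [set U | row a U == row b U]).
Proof.
move=> ab; exists (fun=> 1%N); first exact: small_cst (finNzRing_gt1 F) _.
move=> n S; rewrite mul1n.
pose N : 'rV[F]_K := delta_mx 0 a - delta_mx 0 b.
have fr : row_free N.
  rewrite /row_free rank_rV; suff -> : N != 0 by [].
  apply/eqP => /rowP/(_ a); rewrite !mxE !eqxx (negPf ab) subr0 => /eqP.
  by rewrite oner_eq0.
have := @card_stack_fiber n 1 N [set a; b] 0 _ _ fr.
rewrite addn1 cards2 => H; apply: leq_trans (H _ _); last 2 first.
- by case: (_ != _).
- move=> i j; rewrite !mxE !inE; apply: contraR; rewrite negb_or => /andP[/negPf -> /negPf ->].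
  by rewrite !andbF subrr.
rewrite leq_mul2r; apply/orP; right; apply/subset_leq_card/subsetP => U.
by rewrite !inE mulmxBl -!rowE subr_eq0 => /andP[/andP[-> _] ->].
Qed.

(** Prescribing both [w = N *m U] and row [a] costs [q ^ (2 n)], against [q ^ n] choices of [w] and
    at most [L] of the row. Column [b] makes the two conditions independent. *)
Lemma rare_row_in_dep a b L (N : 'rV[F]_K) (Q : {set 'I_K})
    (T : forall n, {set 'rV[F]_n} -> 'rV[F]_n -> {set 'rV[F]_n}) :
  a != b -> a \in Q -> (#|Q| <= 3)%N ->
  (forall j, N 0 j != 0 -> j \in Q) -> N 0 b != 0 ->
  (forall n S w, #|T n S w| <= L)%N ->
  rare (fun n S => [set U | row a U \in T n S (N *m U)]).
Proof.
move=> ab aQ Q3 NQ Nb TL; exists (fun=> L); first exact: small_cst (finNzRing_gt1 F) _.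
move=> n S.
have fr : row_free (col_mx (delta_mx 0 a) N : 'M[F]_(1 + 1, K)).
  apply: inj_row_free => v; rewrite -[v]hsubmxK mul_row_col.
  rewrite [lsubmx v]mx11_scalar [rsubmx v]mx11_scalar !mul_scalar_mx.
  set x := _ 0 0; set y := _ 0 0 => /rowP E.
  have y0 : y = 0.
    have := E b; rewrite !mxE eq_sym (negPf ab) andbF mulr0 add0r => /eqP.
    by rewrite mulf_eq0 (negPf Nb) orbF => /eqP.
  have := E a; rewrite !mxE !eqxx y0 mul0r mulr1 addr0 => ->.
  by rewrite !raddf0 row_mx0.
have HQ i j : (col_mx (delta_mx 0 a) N : 'M[F]_(1 + 1, K)) i j != 0 -> j \in Q.
  rewrite !mxE; case: splitP => i' _; rewrite ?mxE ord1; last exact: NQ.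
  by move=> nz; apply: contraNT nz => jQ; case: (j =P a) jQ => [->|]; rewrite ?aQ ?andbF.
rewrite -(@leq_pmul2r (#|F| ^ n)) ?expn_gt0 ?(ltn_trans _ (finNzRing_gt1 F)) //.
rewrite -mulnA -expnD.
have -> : (m.+1 * n + n = (m + (1 + 1)) * n)%N by lia.
apply: (@leq_trans (\sum_(w : 'rV[F]_n) \sum_(t in T n S w) #|F| ^ (K * n))); last first.
  apply: (@leq_trans (\sum_(w : 'rV[F]_n) L * #|F| ^ (K * n))).
    by apply: leq_sum => w _; rewrite sum_nat_const leq_mul2r TL orbT.
  by rewrite sum_nat_const card_mx mul1n mulnC.
rewrite -sum1_card big_distrl /= (partition_big (fun U => N *m U) xpredT) //=.
apply: leq_sum => w _; rewrite (partition_big (row a) (mem (T n S w))) /=; last first.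
  by move=> U; rewrite !inE => /andP[/andP[_ +] /eqP <-].
apply: leq_sum => t _; rewrite -big_distrl /= sum1dep_card.
apply: leq_trans (card_stack_fiber (col_mx t w) Q3 HQ fr).
rewrite leq_mul2r; apply/orP; right; apply/subset_leq_card/subsetP => U.
rewrite !inE mul_col_mx -rowE => /andP[/andP[/andP[/andP[-> _] _] /eqP ->] /eqP ->].
by rewrite eqxx.
Qed.

(** * Spreading out one column class *)

Section ColumnClass.
Variables (I : finType) (L : nat) (c : I -> F) (C : {set I}).
Hypothesis c_neq0 : {in C, forall j, c j != 0}.
Hypothesis C_gt1 : (1 < #|C|)%N.
Local Notation rich := (rich L c).

Section Grouped.
Variable rho : I -> 'I_K.
Implicit Types (Q E : {set 'I_K}) (G : {set I}).

(** The map [rho] need not be the given partition: parts with zero coefficient sum get reassigned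
    later. *)
Definition group (Q : {set 'I_K}) := [set j in C | rho j \in Q].
Definition group_value n (U : 'M[F]_(K, n)) Q := \sum_(j in group Q) c j *: row (rho j) U.

Lemma disjoint_group Q1 Q2 : [disjoint Q1 & Q2] -> [disjoint group Q1 & group Q2].
Proof.
move=> dis; rewrite -setI_eq0; apply/eqP/setP => j; rewrite !inE.
by case: (boolP (rho j \in Q1)) => [/(disjointFr dis) ->|]; rewrite ?andbF.
Qed.

Lemma groupU Q1 Q2 : group (Q1 :|: Q2) = group Q1 :|: group Q2.
Proof. by apply/setP => j; rewrite !inE andb_orr. Qed.

Lemma group_valueU n (U : 'M[F]_(K, n)) Q1 Q2 : [disjoint Q1 & Q2] ->
  group_value U (Q1 :|: Q2) = group_value U Q1 + group_value U Q2.
Proof.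
move=> /disjoint_group dis; rewrite /group_value groupU.
rewrite (eq_bigl [predU group Q1 & group Q2]) ?bigU //= => j.
by rewrite !inE.
Qed.

Lemma group_value1 n (U : 'M[F]_(K, n)) a :
  group_value U [set a] = (\sum_(j in group [set a]) c j) *: row a U.
Proof.
rewrite scaler_suml; apply: eq_bigr => j; rewrite !inE => /andP[_ /eqP ->//].
Qed.

Lemma group_valueE n (U : 'M[F]_(K, n)) Q : group_value U Q =
  (\row_b (if b \in Q then \sum_(j in group [set b]) c j else 0)) *m U.
Proof.
rewrite /group_value (partition_big rho (mem Q)) /=; last by move=> j; rewrite inE => /andP[].
rewrite mulmx_sum_row big_mkcond /=; apply: eq_bigr => b _.
rewrite mxE; case: ifP => bQ; last by rewrite scale0r.
rewrite scaler_suml; apply: eq_big => [j|j]; rewrite !inE.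
  by case: eqP => [->|]; rewrite ?andbF // bQ !andbT.
by move=> /andP[_ /eqP ->].
Qed.

Definition rich_block n (S : {set 'rV[F]_n}) (U : 'M[F]_(K, n)) Q :=
  rich S set0 (group Q) (group_value U Q).

Lemma rich_blockU n (S : {set 'rV[F]_n}) U Q1 Q2 : [disjoint Q1 & Q2] ->
  rich_block S U Q1 -> rich_block S U Q2 -> rich_block S U (Q1 :|: Q2).
Proof.
move=> dis; rewrite /rich_block group_valueU // groupU.
by apply: richD; exact: disjoint_group.
Qed.

Lemma rich_block0 n (S : {set 'rV[F]_n}) U : rich_block S U set0.
Proof.
have g0 : group set0 = set0 by apply/setP => j; rewrite !inE andbF.
apply/rich0P => B _; exists (fun=> 0); rewrite /group_value !g0 ?big_set0 //.
by split=> [j|i j]; rewrite inE.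
Qed.

Lemma rich_block_set1 n (S : {set 'rV[F]_n}) U Q :
  {in Q, forall a, rich_block S U [set a]} -> rich_block S U Q.
Proof.
have [k] := ubnP #|Q|; elim: k => // k IHk in Q *; rewrite ltnS => Qk r1.
have [->|/set0Pn[a aQ]] := eqVneq Q set0; first exact: rich_block0.
rewrite -(setD1K aQ); apply: rich_blockU; first by rewrite disjoints1 !inE eqxx.
- exact: r1.
- apply: IHk => [|b /setD1P[_ /r1]//].
  by move: Qk; rewrite (cardsD1 a) aQ.
Qed.

(** Cut off pairs until two or three variables remain. Larger blocks would exceed the three
    variables that [card_stack_fiber] allows. *)
Lemma rich_block_set23 n (S : {set 'rV[F]_n}) U E : (1 < #|E|)%N ->
  (forall Q : {set 'I_K}, Q \subset E -> (1 < #|Q| <= 3)%N -> rich_block S U Q) ->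
  rich_block S U E.
Proof.
have [k] := ubnP #|E|; elim: k => // k IHk in E *; rewrite ltnS => Ek E1 r23.
have [E3|E4] := leqP #|E| 3; first by apply: r23; rewrite ?E1.
have [Q QE Q2] : exists2 Q : {set 'I_K}, Q \subset E & #|Q| = 2%N.
  have [a aE] : exists a, a \in E by apply/set0Pn; rewrite -card_gt0; lia.
  have [b bE] : exists b, b \in E :\ a.
    by apply/set0Pn; rewrite -card_gt0; have := cardsD1 a E; rewrite aE; lia.
  exists [set a; b]; first by rewrite subUset !sub1set aE; case/setD1P: bE.
  by rewrite cards2 eq_sym; case/setD1P: bE => ->.
have cD : (#|E :\: Q| = #|E| - 2)%N by rewrite cardsD (setIidPr QE) Q2.
have -> : E = Q :|: (E :\: Q) by rewrite -{1}(setIidPr QE) setID.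
apply: rich_blockU.
- by rewrite -setI_eq0; apply/eqP/setP => j; rewrite !inE; case: (j \in Q).
- by apply: r23; rewrite ?Q2.
- apply: IHk; [lia|lia|] => Q' sQ' cQ'; apply: r23 => //.
  exact: subset_trans sQ' (subsetDl _ _).
Qed.

(** One deleted set defeating every representation of [w], or [set0] if [w] is rich. It depends on
    [U] only through the block value, as [rare_row_in_dep] demands. *)
Definition obstruction n (S : {set 'rV[F]_n}) G w : {set 'rV[F]_n} :=
  odflt set0 [pick B : {set 'rV[F]_n} | (#|B| + #|G| <= L)%N &&
   [forall x : {ffun I -> 'rV[F]_n}, ~~ [&& [forall j in G, x j \in S :\: B],
       dinjectiveb x G & \sum_(j in G) c j *: x j == w]]].

Lemma card_obstruction n (S : {set 'rV[F]_n}) G w : (#|obstruction S G w| <= L)%N.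
Proof.
rewrite /obstruction; case: pickP => [B /andP[le _]|_] /=; last by rewrite cards0.
by apply: leq_trans le; rewrite leq_addr.
Qed.

Lemma rich_obstruction n (S : {set 'rV[F]_n}) G w :
  ((#|obstruction S G w| + #|G| <= L)%N ->
     exists2 x, places S (obstruction S G w) G x & \sum_(j in G) c j *: x j = w) ->
  rich S set0 G w.
Proof.
rewrite /obstruction; case: pickP => [B /andP[le /forallP H]|H _] /=.
  case=> // x [xS xi] xE; case/negP: (H [ffun j => x j]); apply/and3P; split.
  - by apply/forall_inP => j jG; rewrite ffunE xS.
  - by apply/dinjectiveP => i j iG jG; rewrite !ffunE; exact: xi.
  - by rewrite -xE; apply/eqP; apply: eq_bigr => j _; rewrite ffunE.
apply/rich0P => B le; have /negbT := H B; rewrite le negb_forall => /existsP[x].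
rewrite negbK => /and3P[/forall_inP xS /dinjectiveP xi /eqP xE].
by exists x.
Qed.

(** A poor block forces one of three rare events: a group of several columns sits at a poor point,
    two rows coincide, or a row of the block meets its obstruction. *)
Lemma rare_poor_block (E Q : {set 'I_K}) : Q \subset E -> (1 < #|Q| <= 3)%N ->
  {in E, forall a, \sum_(j in group [set a]) c j != 0} ->
  rare (fun n S => [set U | ~~ rich_block S U Q]).
Proof.
move=> QE /andP[Q1 Q3] eE.
have eQ a : a \in Q -> \sum_(j in group [set a]) c j != 0 by move=> /(subsetP QE) /eE.
pose E1 a : event := fun n S => [set U | (row a U \in S) && ~~ rich_block S U [set a]].
pose E2 (p : 'I_K * 'I_K) : event := fun n S => [set U | row p.1 U == row p.2 U].
pose E3 a : event := fun n S =>
  [set U | row a U \in obstruction S (group Q) (group_value U Q)].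
have r1 : rare (fun n S => \bigcup_(a | (a \in Q) && (1 < #|group [set a]|)%N) E1 a n S).
  apply: rare_bigcup => a /andP[aQ ga].
  have [|f sf Hf] := @few_poor_main R F I L c _ ga _ (eQ a aQ).
    by move=> j; rewrite inE => /andP[/c_neq0].
  pose T n (S : {set 'rV[F]_n}) := [set u in S |
    ~~ rich S set0 (group [set a]) ((\sum_(j in group [set a]) c j) *: u)].
  apply: rareS (@rare_row_in a f T sf _) => [n S U _|n S].
    by rewrite !inE /rich_block group_value1.
  apply: (Hf n S); first by apply/subsetP => u; rewrite inE => /andP[].
  by move=> u; rewrite inE => /andP[].
have r2 : rare (fun n S => \bigcup_(p | p.1 != p.2) E2 p n S).
  by apply: rare_bigcup => p; exact: rare_row_eq.
have r3 : rare (fun n S => \bigcup_(a in Q) E3 a n S).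
  apply: rare_bigcup => a aQ.
  (* A second variable in [Q] keeps row [a] free once the block value is fixed; this uses
     [1 < #|Q|]. *)
  have [b bQ] : exists b, b \in Q :\ a.
    by apply/set0Pn; rewrite -card_gt0; have := cardsD1 a Q; rewrite aQ; lia.
  have [ba {}bQ] := setD1P bQ.
  pose N := \row_b (if b \in Q then \sum_(j in group [set b]) c j else 0).
  apply: rareS (@rare_row_in_dep a b L N Q (fun n S w => obstruction S (group Q) w) _ _ _ _ _ _) => //.
  - by move=> n S U _; rewrite !inE group_valueE.
  - by rewrite eq_sym.
  - by move=> j; rewrite mxE; case: ifP => // _; rewrite eqxx.
  - by rewrite mxE bQ eQ.
  - by move=> n S w; exact: card_obstruction.
apply: rareS (rareU r1 (rareU r2 r3)) => n S U; rewrite inE => /andP[_ /forallP US].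
rewrite !inE; apply: contraR; rewrite !negb_or => /and3P[n1 n2 n3].
(* Keep [row a U] where the group of [a] is a singleton and spread out the other groups. *)
apply: rich_obstruction; set B := obstruction _ _ _ => cB.
pose Q1' := [set a in Q | #|group [set a]| == 1%N].
have Q1Q : Q1' \subset Q by apply/subsetP => a; rewrite inE => /andP[].
have QU : Q = Q1' :|: (Q :\: Q1') by rewrite -{1}(setIidPr Q1Q) setID.
have dQ : [disjoint Q1' & Q :\: Q1'].
  by rewrite -setI_eq0; apply/eqP/setP => j; rewrite !inE; case: (j \in Q) => //=; case: (_ == _).
have richQ : rich_block S U (Q :\: Q1').
  apply: rich_block_set1 => a; rewrite !inE => /andP[+ aQ]; rewrite aQ /= => ga.
  apply: contraR n1 => na; apply/bigcupP; exists a; last by rewrite inE US.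
  rewrite aQ ltn_neqAle eq_sym ga card_gt0; apply: contraTneq (eQ a aQ) => ->.
  by rewrite big_set0 eqxx.
have pl : places S B (group Q1') (fun j => row (rho j) U).
  split=> [j|i j].
    rewrite !inE US andbT => /and3P[_ jQ _]; apply: contra n3 => jB.
    by apply/bigcupP; exists (rho j); rewrite // inE.
  rewrite !inE => /and3P[iC iQ i1] /and3P[jC jQ _] E0.
  have rij : rho i = rho j.
    apply/eqP; apply: contraR n2 => nij; apply/bigcupP.
    by exists (rho i, rho j); rewrite // inE E0.
  have [i0 gi0] := cards1P i1.
  have : i \in group [set rho i] by rewrite !inE iC /=.
  have : j \in group [set rho i] by rewrite !inE jC rij /=.
  by rewrite gi0 => /set1P -> /set1P ->.
have gQ : group Q = group Q1' :|: group (Q :\: Q1') by rewrite {1}QU groupU.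
have dg := disjoint_group dQ.
have := richQ => /rich0P.
move=> /(_ (B :|: (fun j => row (rho j) U) @: group Q1')) [|y py yE].
  by apply: leq_card_glue => //; rewrite -gQ.
exists (glue (group Q1') (fun j => row (rho j) U) y).
  by rewrite gQ; exact: places_glue.
rewrite [in LHS]gQ (sum_glue (fun j v => c j *: v)) // yE.
by rewrite [RHS](congr1 _ QU) group_valueU.
Qed.

Lemma rare_poor_grouped (E : {set 'I_K}) : E != set0 ->
  {in C, forall j, rho j \in E} ->
  {in E, forall a, \sum_(j in group [set a]) c j != 0} ->
  rare (fun n S => [set U | ~~ rich S set0 C (\sum_(j in C) c j *: row (rho j) U)]).
Proof.
move=> E0 CE eE.
have gE : group E = C by apply/setP => j; rewrite !inE andb_idr //; exact: CE.
have [E1|/= E1] := leqP #|E| 1; last first.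
  have : rare (fun n S => \bigcup_(Q : {set 'I_K} | (Q \subset E) && (1 < #|Q| <= 3)%N)
     [set U : 'M[F]_(K, n) | ~~ rich_block S U Q]).
    by apply: rare_bigcup => Q /andP[QE cQ]; exact: rare_poor_block QE cQ eE.
  apply: rareS => n S U _; rewrite inE; apply: contraR => nB.
  have : rich_block S U E.
    apply: rich_block_set23 => // Q QE cQ; apply: contraR nB => nr.
    by apply/bigcupP; exists Q; rewrite ?QE // inE.
  by rewrite /rich_block /group_value gE.
have {E1 E0} /cards1P[a Ea] : #|E| == 1%N by rewrite eqn_leq E1 card_gt0.
have eC : \sum_(j in C) c j != 0 by have := eE a; rewrite -Ea gE; apply; rewrite Ea set11.
have [f sf Hf] := few_poor_main R L C_gt1 c_neq0 eC.
pose T n (S : {set 'rV[F]_n}) := [set u in S | ~~ rich S set0 C ((\sum_(j in C) c j) *: u)].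
apply: rareS (@rare_row_in a f T sf _) => [n S U|n S].
  have sumE : \sum_(j in C) c j *: row (rho j) U = (\sum_(j in C) c j) *: row a U.
    by rewrite scaler_suml; apply: eq_bigr => j /CE; rewrite Ea => /set1P ->.
  by rewrite !inE sumE => /andP[_ /forallP ->].
apply: (Hf n S); first by apply/subsetP => u; rewrite inE => /andP[].
by move=> u; rewrite inE => /andP[].
Qed.

End Grouped.

(** Put [j0] at a point [u] for which [C :\ j0] is rich and spread out the rest from [u]. Such a [u]
    survives the deletion because [S] has more than [f + L] points. *)
Lemma rich_zero n (S : {set 'rV[F]_n}) j0 f : j0 \in C ->
  (forall U : {set 'rV[F]_n}, U \subset S ->
     {in U, forall u, ~~ rich S set0 (C :\ j0) ((\sum_(j in C :\ j0) c j) *: u)} ->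
     (#|U| <= f)%N) ->
  \sum_(j in C) c j = 0 -> (f + L < #|S|)%N -> rich S set0 C 0.
Proof.
move=> jC poor C0 big; apply/rich0P => B cB.
have [/exists_inP[u uS ur]|] := boolP [exists u in S :\: B,
    rich S set0 (C :\ j0) ((\sum_(j in C :\ j0) c j) *: u)]; last first.
  rewrite negb_exists_in => /forall_inP H.
  have := poor (S :\: B) (subsetDl _ _) H.
  have := cardsID B S; have := subset_leq_card (subsetIr S B); lia.
have CE : [set j0] :|: (C :\ j0) = C by exact: setD1K.
have dis : [disjoint [set j0] & C :\ j0] by rewrite disjoints1 !inE eqxx.
have pl : places S B [set j0] (fun=> u).
  by split=> [j _ //|i j /set1P -> /set1P ->].
move/rich0P: ur => /(_ (B :|: (fun=> u) @: [set j0])) [|y py yE].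
  by apply: leq_card_glue; rewrite ?CE.
exists (glue [set j0] (fun=> u) y); first by rewrite -{1}CE; exact: places_glue.
rewrite -{1}CE (sum_glue (fun j v => c j *: v)) // yE big_set1 -scalerDl.
by rewrite -(big_setD1 j0) //= C0 scale0r.
Qed.

(** Parts with zero sum add nothing to the value, so their columns may be moved anywhere. If all
    sums vanish, [rich_zero] is used, and it needs two columns besides [j0]. *)
Lemma rare_poor_class (part : I -> 'I_K) :
  ((forall a, \sum_(j in C | part j == a) c j = 0) -> (2 < #|C|)%N) ->
  rare (fun n S => [set U | ~~ rich S set0 C (\sum_(j in C) c j *: row (part j) U)]).
Proof.
move=> C3; pose e a := \sum_(j in C | part j == a) c j.
pose E := [set a | e a != 0].
have e0 a : a \notin E -> e a = 0 by rewrite inE negbK => /eqP.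
have outE (V : lmodType F) (h : 'I_K -> V) :
    \sum_(j in C | part j \notin E) c j *: h (part j) = 0.
  rewrite (partition_big part (fun a => a \notin E)) /=; last by move=> j /andP[].
  rewrite big1 // => a aE; transitivity (e a *: h a); last by rewrite e0 ?scale0r.
  rewrite scaler_suml; apply: eq_big => [j|j /andP[_ /eqP ->]//].
  by case: eqP => [->|]; rewrite ?andbF // aE !andbT.
have [E0|E0] := eqVneq E set0.
  have {}e0 a : e a = 0 by apply: e0; rewrite E0 inE.
  have {}C3 := C3 e0.
  have [j0 jC] : exists j, j \in C by apply/set0Pn; rewrite -card_gt0; lia.
  have cD : (1 < #|C :\ j0|)%N by have := cardsD1 j0 C; rewrite jC; lia.
  have C0 : \sum_(j in C) c j = 0.
    by rewrite (partition_big part xpredT) //= big1 // => a _; exact: e0.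
  have eD : \sum_(j in C :\ j0) c j != 0.
    move: C0; rewrite (big_setD1 j0) //= => /eqP; rewrite addrC addr_eq0 => /eqP ->.
    by rewrite oppr_eq0 c_neq0.
  have [|f sf Hf] := few_poor_main R L cD _ eD.
    by move=> j /setD1P[_ /c_neq0].
  (* Only a small [S] is exceptional here. As the row of [part j0] lies in [S], this is recorded as
     that row lying in a small set. *)
  pose T n (S : {set 'rV[F]_n}) := if (#|S| <= f n + L)%N then S else set0.
  have sfL : small (fun n => f n + L)%N.
    by apply: smallD => //; exact: small_cst (finNzRing_gt1 F) _.
  apply: rareS (@rare_row_in (part j0) _ T sfL _) => [n S U|n S]; last first.
    by rewrite /T; case: ifP => // _; rewrite cards0.
  rewrite !inE => /andP[_ /forallP US]; apply: contraR => nT.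
  have -> : \sum_(j in C) c j *: row (part j) U = 0.
    rewrite -[RHS](outE _ (fun a => row a U)); apply: eq_bigl => j.
    by rewrite E0 inE andbT.
  apply: (rich_zero jC (Hf n S)) => //.
  by rewrite ltnNge; apply: contra nT => le; rewrite /T le US.
have [a0 a0E] := set0Pn _ E0.
(* The parts with zero coefficient sum are absorbed into the part [a0]. *)
pose rho j := if part j \in E then part j else a0.
have rhoE j : rho j \in E by rewrite /rho; case: ifP.
have split_sum (V : lmodType F) (h : 'I_K -> V) :
    \sum_(j in C) c j *: h (rho j) = \sum_(j in C) c j *: h (part j).
  rewrite (bigID (fun j => part j \in E)) [RHS](bigID (fun j => part j \in E)) /=.
  rewrite outE; congr (_ + _).
    by apply: eq_bigr => j /andP[_ jE]; rewrite /rho jE.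
  rewrite -[RHS](outE _ (fun=> h a0)); apply: eq_bigr => j /andP[_ /negPf jE].
  by rewrite /rho jE.
have : {in E, forall a, \sum_(j in group rho [set a]) c j != 0}.
  move=> a aE; suff -> : \sum_(j in group rho [set a]) c j = e a by move: aE; rewrite inE.
  (* Taking the indicator of [a] for [h] shows that the reassignment preserves the coefficient sum
     at [a]. *)
  have sE := @split_sum F^o (fun b => (b == a)%:R).
  have H (p : I -> 'I_K) : \sum_(j in C) c j *: ((p j == a)%:R : F^o) = \sum_(j in C | p j == a) c j.
    rewrite big_mkcondr; apply: eq_bigr => j _; case: eqP => _; last by rewrite scaler0.
    by rewrite /GRing.scale /= mulr1.
  by rewrite !H in sE; rewrite /e -sE; apply: eq_bigl => j; rewrite !inE.
move/(rare_poor_grouped E0 (fun j _ => rhoE j)); apply: rareS => n S U _.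
by rewrite !inE (split_sum _ (fun a => row a U)).
Qed.

End ColumnClass.
End Rare.

(** * Counting and assembly *)

(** Cauchy-Schwarz for the fibre sizes [N w], obtained by summing
    [2 * (N w * N w') <= N w ^ 2 + N w' ^ 2] over all pairs. *)
Lemma card_collisions (T T' : finType) (X : {set T}) (f : T -> T') :
  (#|X| ^ 2 <= #|T'| * #|[set p in setX X X | f p.1 == f p.2]|)%N.
Proof.
pose N w := #|[set x in X | f x == w]|.
have cX : #|X| = (\sum_w N w)%N.
  rewrite -sum1_card (partition_big f xpredT) //=; apply: eq_bigr => w _.
  by rewrite /N -sum1dep_card.
have cD : #|[set p in setX X X | f p.1 == f p.2]| = (\sum_w N w ^ 2)%N.
  rewrite -sum1_card (partition_big (fun p => f p.1) xpredT) //=.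
  apply: eq_bigr => w _; rewrite sum1dep_card -mulnn -cardsX; apply: eq_card => -[x y].
  rewrite !inE /=; case: (f x =P w) => [->|]; rewrite ?andbF ?andbT //.
  by rewrite -andbA eq_sym.
have eq2 : (2 * #|X| ^ 2 <= 2 * (#|T'| * \sum_w N w ^ 2))%N.
  rewrite cX -mulnn big_distrl big_distrr /=.
  apply: (@leq_trans (\sum_w \sum_w' (N w ^ 2 + N w' ^ 2))%N).
    by apply: leq_sum => w _; rewrite !big_distrr /=; apply: leq_sum => w' _; exact: nat_Cauchy.
  under eq_bigr do rewrite big_split /= sum_nat_const.
  by rewrite big_split /= sum_nat_const -big_distrr /= mul2n addnn.
by rewrite cD -(leq_pmul2l (isT : 0 < 2)%N).
Qed.

(** Collisions of [Y |-> A *m Y] on [s]-tuples from [S] are solutions for [row_mx A (- A)]. *)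
Lemma card_solutions_lower (F : finFieldType) m s n (A : 'M[F]_(m, s)) (S : {set 'rV[F]_n}) :
  (#|S| ^ (s + s) <= #|F| ^ (m * n) * #|solutions (row_mx A (- A)) S|)%N.
Proof.
pose X := [set Y : 'M[F]_(s, n) | [forall r, row r Y \in S]].
have cX : (#|S| ^ s <= #|X|)%N.
  pose h (f : {ffun 'I_s -> 'rV[F]_n}) : 'M[F]_(s, n) := \matrix_(i, j) f i 0 j.
  have rh f r : row r (h f) = f r by apply/rowP => j; rewrite !mxE.
  have hinj : injective h.
    by move=> f g fg; apply/ffunP => r; rewrite -!rh fg.
  rewrite -[X in (_ ^ X)%N](card_ord s) -card_ffun_on -(card_imset _ hinj).
  apply/subset_leq_card/subsetP => _ /imsetP[f /ffun_onP fS ->].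
  by rewrite inE; apply/forallP => r; rewrite rh; exact: fS.
have := card_collisions X (mulmx A : 'M[F]_(s, n) -> 'M[F]_(m, n)).
rewrite card_mx => le.
have -> : (#|S| ^ (s + s) = (#|S| ^ s) ^ 2)%N by rewrite -expnM muln2 addnn.
apply: leq_trans (leq_trans _ le) _; first by rewrite leq_exp2r.
rewrite leq_mul2l; apply/orP; right.
rewrite -(card_in_imset (f := fun p : 'M[F]_(s, n) * 'M[F]_(s, n) => col_mx p.1 p.2)); last first.
  by move=> [Y Z] [Y' Z'] _ _ /= /eq_col_mx[-> ->].
apply/subset_leq_card/subsetP => _ /imsetP[[Y Z] + ->].
rewrite !inE /= => /andP[/andP[/forallP YS /forallP ZS] /eqP E].
rewrite mul_row_col mulNmx E subrr eqxx /=; apply/forallP => a.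
case: (split_ordP a) => r ->; first by rewrite rowKu YS.
by rewrite rowKd ZS.
Qed.

(** The new base [q (1 - t)] has [K t = 1 - g / q], so Bernoulli gives [(1 - t) ^ K >= g / q].
    Passing from [b] to [b + 1] makes the inequality strict. *)
Lemma small_threshold (R : realType) (q K : nat) f : (1 < q)%N -> (0 < K)%N -> small R q f ->
  exists b g : R, [/\ 0 < b, 0 < g, g < q%:R & forall n N : nat,
    b * g ^+ n <= N%:R -> (f n * q ^ (K * n) < N ^ K * q ^ n)%N].
Proof.
move=> q1 K0 [b [g [b0 g0 gq fE]]].
have q0 : 0 < q%:R :> R by rewrite ltr0n; lia.
have K1 : 1 <= K%:R :> R by rewrite ler1n.
pose t : R := (1 - g / q%:R) / K%:R.
have gq1 : 0 < g / q%:R < 1 by rewrite divr_gt0 //= ltr_pdivrMr // mul1r.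
have Kt : K%:R * t = 1 - g / q%:R by rewrite /t mulrC divfK //; lra.
have t0 : 0 < t by rewrite divr_gt0; lra.
have t1 : t < 1.
  apply: le_lt_trans (_ : K%:R * t < 1); last by rewrite Kt; lra.
  by rewrite ler_peMl // ltW.
exists (b + 1), (q%:R * (1 - t)); split.
- lra.
- by rewrite mulr_gt0 //; lra.
- by rewrite gtr_pMr //; lra.
move=> n N le; rewrite -(ltr_nat R) !natrM !natrX.
have bg0 : 0 <= (b + 1) * (q%:R * (1 - t)) ^+ n.
  by rewrite mulr_ge0 ?exprn_ge0 ?mulr_ge0 //; lra.
have : ((b + 1) * (q%:R * (1 - t)) ^+ n) ^+ K <= N%:R ^+ K.
  by apply: lerXn2r; rewrite ?nnegrE.
rewrite exprMn => leK.
have b1 : b + 1 <= (b + 1) ^+ K.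
  by rewrite -[X in X <= _]expr1; apply: ler_weXn2l => //; lra.
have gK : g / q%:R <= (1 - t) ^+ K.
  apply: le_trans (exprB1_ge K (_ : 0 <= t <= 1)); first by rewrite Kt; lra.
  by apply/andP; split; lra.
have gKn : (g / q%:R) ^+ n <= ((1 - t) ^+ n) ^+ K.
  by rewrite exprAC; apply: lerXn2r; rewrite ?nnegrE ?exprn_ge0 //; lra.
have {}leK : (b + 1) * (q%:R ^+ (K * n) * (g / q%:R) ^+ n) <= N%:R ^+ K.
  apply: le_trans leK.
  have -> : ((q%:R * (1 - t)) ^+ n) ^+ K = q%:R ^+ (K * n) * ((1 - t) ^+ n) ^+ K.
    by rewrite !exprMn -exprM (mulnC n K).
  apply: ler_pM => //; first lra.
    by rewrite mulr_ge0 ?exprn_ge0 //; lra.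
  by rewrite ler_wpM2l ?exprn_ge0 //; lra.
have Q0 : 0 < q%:R ^+ (K * n) :> R by rewrite exprn_gt0.
have G0 : 0 < g ^+ n by rewrite exprn_gt0.
apply: lt_le_trans (_ : (b + 1) * (q%:R ^+ (K * n) * g ^+ n) <= _).
  apply: le_lt_trans (_ : b * g ^+ n * q%:R ^+ (K * n) < _).
    by rewrite ler_wpM2r // ltW.
  have := mulr_gt0 Q0 G0; set x := q%:R ^+ (K * n); set y := g ^+ n; nra.
have -> : g ^+ n = (g / q%:R) ^+ n * q%:R ^+ n by rewrite -exprMn divfK //; lra.
by rewrite !mulrA ler_wpM2r ?exprn_ge0 // -?mulrA // ltW.
Qed.

(** * Column classes and their simultaneous placement *)

Section ColumnEquivalence.
Variables (F : finFieldType) (m k : nat) (A : 'M[F]_(m, k)).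

Lemma col_equivP j j' :
  reflect (exists2 c, c != 0 & col j' A = c *: col j A) (col_equiv A j j').
Proof.
apply: (iffP existsP) => [[c /andP[c0 /eqP E]]|[c c0 E]].
  by exists c^-1; rewrite ?invr_eq0 // E scalerA mulVf // scale1r.
by exists c^-1; rewrite invr_eq0 c0 E scalerA mulVf // scale1r eqxx.
Qed.

Lemma col_equiv_refl j : col_equiv A j j.
Proof. by apply/col_equivP; exists 1; rewrite ?oner_eq0 ?scale1r. Qed.

Lemma col_equiv_sym j j' : col_equiv A j j' -> col_equiv A j' j.
Proof.
move=> /col_equivP[c c0 E]; apply/col_equivP; exists c^-1; rewrite ?invr_eq0 //.
by rewrite E scalerA mulVf // scale1r.
Qed.

Lemma col_equiv_trans j j' j'' : col_equiv A j j' -> col_equiv A j' j'' -> col_equiv A j j''.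
Proof.
move=> /col_equivP[c c0 E] /col_equivP[d d0 E']; apply/col_equivP.
by exists (d * c); rewrite ?mulf_neq0 // E' E scalerA.
Qed.

(** The default 1 keeps the ratio nonzero for inequivalent columns too. *)
Definition col_ratio j j' : F := odflt 1 [pick c | (c != 0) && (col j' A == c *: col j A)].

Lemma col_ratio_neq0 j j' : col_ratio j j' != 0.
Proof. by rewrite /col_ratio; case: pickP => [c /andP[]|_] //=; rewrite oner_eq0. Qed.

Lemma col_ratioE j j' : j' \in col_class A j -> col j' A = col_ratio j j' *: col j A.
Proof.
rewrite inE => /col_equivP[c c0 E]; rewrite /col_ratio; case: pickP => [d /andP[_ /eqP]//|].
by move=> /(_ c); rewrite c0 E eqxx.
Qed.

Variables (n : nat) (S : {set 'rV[F]_n}) (u : 'I_k -> 'rV[F]_n).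

(** An equation sees a class only through the sum weighted by the ratios. Classes are placed one by
    one, deleting the points already used; the budget [k] covers all columns. *)
Lemma places_classes (X : {set 'I_k}) (B : {set 'rV[F]_n}) :
  {in X, forall j, col_class A j \subset X /\
     rich k (col_ratio j) S set0 (col_class A j)
       (\sum_(j' in col_class A j) col_ratio j j' *: u j')} ->
  (#|B| + #|X| <= k)%N ->
  exists2 x, places S B X x & forall i, \sum_(j in X) A i j *: x j = \sum_(j in X) A i j *: u j.
Proof.
have [N] := ubnP #|X|; elim: N => // N IHN in X B *; rewrite ltnS => XN HX cB.
have [->|/set0Pn[j0 j0X]] := eqVneq X set0.
  by exists (fun=> 0) => [|i]; rewrite ?big_set0 //; split=> [j|i j]; rewrite inE.
have [CX /rich0P richC] := HX j0 j0X; set C := col_class A j0 in CX richC.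
have CE : C :|: (X :\: C) = X by rewrite -{1}(setIidPr CX) setID.
have dis : [disjoint C & X :\: C].
  by rewrite -setI_eq0; apply/eqP/setP => j; rewrite !inE; case: (col_equiv _ _ _).
have [|y py yE] := richC B.
  by apply: leq_trans cB; rewrite leq_add2l subset_leq_card.
have yA i : \sum_(j in C) A i j *: y j = \sum_(j in C) A i j *: u j.
  have cE j : j \in C -> A i j = A i j0 * col_ratio j0 j.
    by move=> /col_ratioE/colP/(_ i); rewrite !mxE mulrC.
  transitivity (A i j0 *: \sum_(j in C) col_ratio j0 j *: y j).
    by rewrite scaler_sumr; apply: eq_bigr => j jC; rewrite cE // scalerA.
  rewrite yE scaler_sumr; apply: eq_bigr => j jC; by rewrite [in RHS]cE // scalerA.
have [||| z pz zE] := IHN (X :\: C) (B :|: y @: C).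
- apply: leq_trans XN; apply: proper_card; apply/properP; split; first exact: subsetDl.
  by exists j0 => //; rewrite !inE col_equiv_refl.
- move=> j /setDP[jX jC]; have [sj rj] := HX j jX; split=> //.
  apply/subsetP => j' jj'; rewrite inE (subsetP sj) // andbT.
  apply: contra jC; rewrite !inE in jj' * => jj0.
  exact: col_equiv_trans jj0 (col_equiv_sym jj').
- by apply: leq_card_glue => //; rewrite CE.
exists (glue C y z); first by rewrite -CE; exact: places_glue.
move=> i; rewrite -CE (sum_glue (fun j v => A i j *: v)) // yA zE.
have := sum_glue (fun j v => A i j *: v) u u dis; rewrite /glue => <-.
by apply: eq_bigr => j _; case: ifP.
Qed.

End ColumnEquivalence.

Theorem theorem4p2 (R : realType) (F : finFieldType) (m k : nat)
    (A : 'M[F]_(m, k)) (s : nat) (P : 'I_(s + s) -> {set 'I_k}) :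
  typeRC A -> non_degenerate A -> irreducible A ->
  (* P_1, ..., P_{2s} is a partition of [k] (P_r = P (lshift s r),
     P_{s+r} = P (rshift s r)) *)
  (forall a, P a != set0) ->
  (forall a b, a != b -> [disjoint P a & P b]) ->
  (forall j : 'I_k, exists a, j \in P a) ->
  (* (i) *)
  (forall r : 'I_s,
     \sum_(j in P (lshift s r) :|: P (rshift s r)) col j A = 0) ->
  (* (ii) *)
  (forall u : 'rV[F]_m, u *m A != 0 ->
     exists r1 r2 : 'I_s, r1 != r2 /\
       \sum_(j in P (lshift s r1)) (u *m A) 0 j != 0 /\
       \sum_(j in P (lshift s r2)) (u *m A) 0 j != 0) ->
  (* (iii) *)
  (forall C : {set 'I_k}, is_col_class A C -> #|C| = 2%N ->
     class_sums_to_zero A C ->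
     exists r : 'I_s, C = P (lshift s r) :|: P (rshift s r)) ->
  moderate R A.
Proof.
move=> [_ single] [freeA _] _ P0 Pdis Pcov Psum Pweight Pclass.
have q1 : (1 < #|F|)%N := finNzRing_gt1 F.
have [part partP] := fin_all_exists Pcov.
have partE a j : (j \in P a) = (part j == a).
  apply/idP/eqP => [ja|<-//]; apply/eqP; apply: contraT => /Pdis dis.
  by have := disjointFr dis (partP j); rewrite ja.
(* Without parts there are no columns, and the empty tuple is a shape. *)
have [ss0|ss0] := posnP (s + s)%N.
  have noI (j : 'I_k) : False by have := ltn_ord (part j); rewrite {2}ss0.
  exists 1, 1; split; [|split; [|split]]; rewrite ?ltr01 ?ltr1n // => n S _.
  exists (fun=> 0); split=> [|j]; last by case: (noI j).
  by split=> [i|j]; [rewrite big1 // => j|]; case: (noI j).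
pose A' := \matrix_(i < m, r < s) \sum_(j in P (lshift s r)) A i j.
pose M := row_mx A' (- A').
(* By (i) the columns in the second half of the parts sum to the negatives of those in the first, so
   [M] is the collapsed system. *)
have ME i a : M i a = \sum_(j | part j == a) A i j.
  case: (split_ordP a) => r ->.
    by rewrite row_mxEl mxE; apply: eq_bigl => j; rewrite partE.
  have /colP/(_ i) := Psum r; rewrite summxE mxE.
  rewrite (eq_bigl [predU P (lshift s r) & P (rshift s r)]); last by move=> j; rewrite !inE.
  rewrite bigU ?Pdis ?eq_lrshift //= => /eqP; rewrite addrC addr_eq0 => /eqP E.
  rewrite row_mxEr !mxE; transitivity (\sum_(j in P (rshift s r)) col j A i 0).
    by rewrite E; congr (- _); apply: eq_bigr => j _; rewrite mxE.
  by apply: eq_big => j; rewrite ?partE // mxE.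
(* Each of the two nonzero sums from (ii) occurs in both halves of [M], which makes four nonzero
   entries. *)
have M_weight (y : 'rV[F]_m) : y != 0 -> (3 < #|[set a | ((y *m M) ord0 a != 0)%R]|)%N.
  move=> y0; have : y *m A != 0.
    by apply: contra y0 => /eqP E; rewrite (row_free_inj freeA (_ : y *m A = 0 *m A)) ?mul0mx.
  have yA' r : (y *m A') 0 r = \sum_(j in P (lshift s r)) (y *m A) 0 j.
    rewrite mxE; under eq_bigr do rewrite mxE mulr_sumr.
    by rewrite exchange_big; apply: eq_bigr => j _; rewrite mxE.
  case/Pweight => r1 [r2 [r12 []]]; rewrite -!yA' => n1 n2.
  pose l := [:: lshift s r1; lshift s r2; rshift s r1; rshift s r2].
  have /card_uniqP cl : uniq l.
    by rewrite /= !inE !eq_lshift !eq_rshift !eq_lrshift (negPf r12).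
  apply: (@leq_trans #|l|); first by rewrite cl.
  apply/subset_leq_card/subsetP => a; rewrite !inE mul_mx_row mulmxN.
  by case/or4P => /eqP ->; rewrite ?row_mxEl ?row_mxEr // mxE oppr_eq0.
pose u n (U : 'M[F]_(s + s, n)) j := row (part j) U.
pose bad j n (S : {set 'rV[F]_n}) := [set U : 'M[F]_(s + s, n) |
  ~~ rich k (col_ratio A j) S set0 (col_class A j)
       (\sum_(j' in col_class A j) col_ratio A j j' *: u n U j')].
have : rare R M (fun n S => \bigcup_(j | (1 < #|col_class A j|)%N) bad j n S).
  apply: rare_bigcup => j C1; apply: rare_poor_class => //.
    by move=> j' _; exact: col_ratio_neq0.
  (* If all part sums of a class of size 2 vanish, (iii) makes it the union of two parts. Each is
     then a single column, whose part sum is a nonzero ratio. *)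
  set C := col_class A j => e0; rewrite ltn_neqAle C1 andbT eq_sym; apply/negP => /eqP C2.
  have [||r CE] := Pclass C _ C2; first by exists j.
    rewrite /class_sums_to_zero (partition_big part xpredT) //= big1 // => a _.
    transitivity ((\sum_(j' in C | part j' == a) col_ratio A j j') *: col j A).
      by rewrite scaler_suml; apply: eq_bigr => j' /andP[/col_ratioE].
    by rewrite e0 scale0r.
  have : #|P (lshift s r)| == 1%N.
    have := C2; rewrite CE cardsU disjoint_setI0 ?Pdis ?eq_lrshift // cards0 subn0.
    have : (0 < #|P (lshift s r)|)%N by rewrite card_gt0.
    have : (0 < #|P (rshift s r)|)%N by rewrite card_gt0.
    by case: #|_| => // y _; case: #|_| => // x _; lia.
  case/cards1P => j1 Pj1; have := e0 (lshift s r); rewrite (big_pred1 j1).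
    by move/eqP; rewrite (negPf (col_ratio_neq0 _ _ _)).
  by move=> j'; rewrite -partE CE in_setU Pj1 in_set1 /=; case: eqP; rewrite ?andbF.
move=> [f sf Hf]; have [b [g [b0 g0 gq bgP]]] := small_threshold q1 ss0 sf.
exists b, g; split=> //; split=> //; split=> // n S /bgP big.
(* Were all solutions bad, rareness and the Cauchy-Schwarz lower bound would contradict the
   threshold. *)
have [U US Ugood] : exists2 U, U \in solutions M S &
    U \notin \bigcup_(j | (1 < #|col_class A j|)%N) bad j n S.
  apply/exists_inP; apply: contraLR big => /exists_inPn sub; rewrite -leqNgt.
  apply: leq_trans (Hf n S); rewrite (setIidPl _); last first.
    by apply/subsetP => U /sub; rewrite negbK.
  rewrite mulSn (expnD #|F| n) mulnCA mulnC leq_mul2l; apply/orP; right.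
  by rewrite mulnC; exact: card_solutions_lower.
move: US; rewrite inE => /andP[/eqP MU /forallP US].
have uA i : \sum_j A i j *: u n U j = 0.
  have /rowP MU0 : row i (M *m U) = 0 by rewrite MU row0.
  transitivity (row i (M *m U)); last by rewrite MU row0.
  rewrite row_mul mulmx_sum_row (partition_big part xpredT) //=; apply: eq_bigr => a _.
  rewrite [row i M 0 a]mxE ME scaler_suml; apply: eq_bigr => j /eqP <- //.
(* A column in a singleton class keeps its point. There is at most one by (RC), so it cannot
   collide, and the other classes are placed avoiding that point. *)
pose X1 := [set j | #|col_class A j| == 1%N].
have dis : [disjoint X1 & ~: X1] by rewrite -setI_eq0 setICr.
have p1 : places S set0 X1 (u n U).
  split=> [j _|i j iX jX _]; first by rewrite setD0 US.
  by apply: (card_le1_eqP single).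
have cX : (#|set0 : {set 'rV[F]_n}| + #|X1 :|: ~: X1| <= k)%N.
  by rewrite cards0 setUCr cardsT card_ord.
have [j jX|y py yE] := @places_classes F m k A n S (u n U) (~: X1) _ _ (leq_card_glue (u n U) dis cX).
  have C1 : (1 < #|col_class A j|)%N.
    move: jX; rewrite !inE => jX; rewrite ltn_neqAle eq_sym jX card_gt0.
    by apply/set0Pn; exists j; rewrite inE col_equiv_refl.
  split.
    apply/subsetP => j' jj'; rewrite !inE; suff -> : col_class A j' = col_class A j.
      by rewrite neq_ltn C1 orbT.
    rewrite inE in jj'; apply/setP => j''; rewrite !inE; apply/idP/idP.
      exact: col_equiv_trans.
    exact: col_equiv_trans (col_equiv_sym jj').
  by apply: contraR Ugood => nr; apply/bigcupP; exists j; rewrite // inE.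
have [xS xi] := places_glue p1 py; rewrite setUCr in xS xi.
exists (glue X1 (u n U) y); split; last first.
  by move=> j; have := xS j; rewrite setD0; apply.
split=> [i|i j]; last by apply: xi; rewrite inE.
have := sum_glue (fun j v => A i j *: v) (u n U) y dis; rewrite yE.
have := sum_glue (fun j v => A i j *: v) (u n U) (u n U) dis => /= <-.
rewrite setUCr => E; rewrite -[RHS](uA i); rewrite (eq_bigl _ _ (in_setT (T := 'I_k))) in E.
rewrite E; under eq_bigl do rewrite in_setT.
by apply: eq_bigr => j _; rewrite /glue; case: ifP.
Qed.
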